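(* Let $X$ be a locally compact Hausdorff space, let $E$ be a monotone complete partially ordered vector space, and let $\pi\colon C_c(X)\to E$ be a positive operator. Suppose that $\mu\colon\mathscr B\to E^+$ is a finite regular Borel measure that is inner regular at all Borel subsets of $X$, and such that $\pi(f)=\int_X^{o}f\,d\mu$ for $f\in C_c(X)$; $\mu(V)=\bigvee\{\pi(f):f\prec V\}$ in $E^+$ for every open subset $V$ of $X$; and $\mu(K)=\bigwedge\{\pi(f):K\prec f\}$ in $E^+$ for every compact subset $K$ of $X$. Then $$I_\mu(\mathcal B(X,\mathscr B;\mathbb R))\subseteq[\pi(C_c(X))]^{\Uparrow\Downarrow\uparrow}\cap[\pi(C_c(X))]^{\Downarrow\Uparrow\downarrow}$$ and $$I_\mu(\mathcal B(X,\mathscr B;\mathbb R))\subseteq[\pi(C_c(X))]^{\Uparrow\Downarrow\downarrow}\cap[\pi(C_c(X))]^{\Downarrow\Uparrow\uparrow}.$$ If $E$ has the countable sup property and $I_\mu\colon\mathcal L^1(X,\mathscr B,\mu;\mathbb R)\to E$ preserves moduli, then $$I_\mu(\mathcal B(X,\mathscr B;\mathbb R))\subseteq[\pi(C_c(X))]^{\uparrow\downarrow}\cap[\pi(C_c(X))]^{\downarrow\uparrow}.$$ If $E$ has the countable sup property, $I_\mu\colon\mathcal L^1(X,\mathscr B,\mu;\mathbb R)\to E$ preserves moduli, and $L^1(X,\mathscr B,\mu;\mathbb R)=\mathrm B(X,\mathscr B,\mu;\mathbb R)$, then $$I_\mu(\mathcal B(X,\mathscr B;\mathbb R))=[\pi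(C_c(X))]^{\uparrow\downarrow}=[\pi(C_c(X))]^{\downarrow\uparrow}.$$
   Context: All vector spaces are over $\mathbb R$; $\mathbb R^+=[0,\infty)$. A partially ordered vector space $E$ has a proper (not necessarily generating) positive cone $E^+$ and is always supposed to be Archimedean. $x_\lambda\uparrow x$ (resp. $x_\lambda\downarrow x$) means that $(x_\lambda)$ is an increasing (resp. decreasing) net with supremum (resp. infimum) $x$. $E$ is monotone complete if every increasing net that is bounded above has a supremum. $E$ has the countable sup property if, for every net $(x_\lambda)\subseteq E^+$ and $x\in E^+$ with $x_\lambda\uparrow x$, there is a countable set of indices $\{\lambda_n\}$ with $x=\sup_n x_{\lambda_n}$. An operator $T\colon E\to F$ between partially ordered vector spaces preserves moduli if, whenever $|x|=x\vee(-x)$ exists in $E$, $|Tx|$ exists in $F$ and $T|x|=|Tx|$. $\mathscr B$ is the Borel $\sigma$-algebra of $X$ (generated by the open sets). A finite measure $\mu\colon\mathscr B\to E^+$ is a map with $\mu(\emptyset)=0$ and $\mu(\bigcup_n\Delta_n)=\bigvee_{N}\sum_{n=1}^N\mu(\Delta_n)$ in $E$ for pairwise disjoint sequences. It is inner regular at $\Delta$ if $\mu(\Delta)=\bigvee\{\mu(K):K\subseteq\Delta\text{ compact}\}$, and outer regular at $\Delta$ if $\mu(\Delta)=\bigwedge\{\mu(V):V\supseteq\Delta\text{ open}\}$; it is a regular Borel measure if it is inner regular at all open sets and outer regular at all Borel sets. Order integral: for $\varphi=\sum_{i=1}^n r_i\chi_{\Delta_i}$ with $r_i\in\mathbb R^+$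 and disjoint measurable $\Delta_i$, $\int_X^{o}\varphi\,d\mu=\sum r_i\mu(\Delta_i)$; for measurable $f\colon X\to[0,\infty]$, $\int_X^{o}f\,d\mu=\bigvee_n\int_X^{o}\varphi_n\,d\mu$ in $E^+\cup\{\infty\}$ ($\infty$ adjoined as largest element) for any sequence of such $\varphi_n\uparrow f$ pointwise (independent of the choice). $\mathcal L^1(X,\mathscr B,\mu;\mathbb R)$ consists of the measurable $f\colon X\to\mathbb R$ with $\int_X^{o}|f|\,d\mu\in E$, and then $I_\mu(f)=\int^{o}_X f\,d\mu=\int^{o}_Xf^+\,d\mu-\int^{o}_Xf^-\,d\mu$. $L^1(X,\mathscr B,\mu;\mathbb R)$ is its quotient by the functions vanishing $\mu$-almost everywhere. $\mathcal B(X,\mathscr B;\mathbb R)$ is the space of bounded Borel measurable functions, and $\mathrm B(X,\mathscr B,\mu;\mathbb R)$ its quotient by those vanishing $\mu$-a.e.; $L^1=\mathrm B$ means equality under the canonical identification. $C_c(X)$ is the space of real-valued compactly supported continuous functions. For $S\subseteq X$: $f\prec S$ means $f\in C_c(X)$, $0\le f\le1$, $\operatorname{supp}f\subseteq S$; $S\prec f$ means $f\in C_c(X)$, $0\le f\le 1$, $f=1$ on $S$. For a non-empty subset $S$ of $E$, $S^{\Uparrow}$ (resp. $S^{\uparrow}$) is the set of all $x\in E$ for which there is a net (resp. sequence) in $S$ with $x_\lambda\uparrow x$ in $E$; $S^{\Downarrow}$ and $S^{\downarrow}$ are defined similarly with decreasing nets, resp. sequences; $S^{\Uparrow\Downarrow\uparrow}=((S^{\Uparrow})^{\Downarrow})^{\uparrow}$,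 etc. *)

(* Defs.v *)
From HB Require Import structures.
From mathcomp Require Import all_boot all_order all_algebra.
From mathcomp Require Import all_classical all_reals all_analysis.
Import Order.TTheory GRing.Theory Num.Theory.
Import numFieldNormedType.Exports.

Set Implicit Arguments.
Unset Strict Implicit.
Unset Printing Implicit Defensive.

Local Open Scope classical_set_scope.
Local Open Scope ring_scope.

(* Archimedean partially ordered vector spaces. The cone [0 <= x] is proper
   because [<=] is antisymmetric; it need not be generating. *)
HB.mixin Record Lmodule_isArchiOrdered (R : numDomainType) V
    of GRing.Lmodule R V & Order.isPOrder ring_display V := {
  povs_leD2r : forall x y z : V, x <= y -> x + z <= y + z;
  povs_scale_ge0 : forall (a : R) (x : V), 0 <= a -> 0 <= x -> 0 <= a *: x;
  povs_archi : forall x y : V, (forall n : nat, x *+ n.+1 <= y) -> x <= 0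
}.

#[short(type="povsType")]
HB.structure Definition ArchiPOVectorSpace (R : numDomainType) :=
  { V of GRing.Lmodule R V & Order.isPOrder ring_display V
       & Lmodule_isArchiOrdered R V }.

Section OrderConvergence.
Context {d : Order.disp_t} {T : porderType d}.

Definition sup_in (P A : set T) (m : T) :=
  [/\ P m, ubound A m & forall z, P z -> ubound A z -> (m <= z)%O].

Definition inf_in (P A : set T) (m : T) :=
  [/\ P m, lbound A m & forall z, P z -> lbound A z -> (z <= m)%O].

Record directed (I : Type) (leI : I -> I -> Prop) : Prop := {
  directed_inhabited : inhabited I;
  directed_refl : forall i, leI i i;
  directed_trans : forall i j k, leI i j -> leI j k -> leI i k;
  directed_ub : forall i j, exists k, leI i k /\ leI j k
}.

Definition net_increasing (I : Type) (leI : I -> I -> Prop) (u : I -> T) :=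
  forall i j, leI i j -> (u i <= u j)%O.

Definition net_decreasing (I : Type) (leI : I -> I -> Prop) (u : I -> T) :=
  forall i j, leI i j -> (u j <= u i)%O.

Definition net_increases_to I (leI : I -> I -> Prop) (u : I -> T) (x : T) :=
  net_increasing leI u /\ supremums (range u) x.

Definition net_decreases_to I (leI : I -> I -> Prop) (u : I -> T) (x : T) :=
  net_decreasing leI u /\ infimums (range u) x.

Definition seq_increases_to (u : nat -> T) (x : T) :=
  nondecreasing_seq u /\ supremums (range u) x.

Definition seq_decreases_to (u : nat -> T) (x : T) :=
  nonincreasing_seq u /\ infimums (range u) x.

(* The four operations S^{Uparrow}, S^{Downarrow} (nets) and
   S^{uparrow}, S^{downarrow} (sequences). *)
Definition net_up (S : set T) : set T :=
  [set x | exists (I : Type) (leI : I -> I -> Prop) (u : I -> T),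
    [/\ directed leI, forall i, S (u i) & net_increases_to leI u x]].

Definition net_down (S : set T) : set T :=
  [set x | exists (I : Type) (leI : I -> I -> Prop) (u : I -> T),
    [/\ directed leI, forall i, S (u i) & net_decreases_to leI u x]].

Definition seq_up (S : set T) : set T :=
  [set x | exists u : nat -> T, (forall n, S (u n)) /\ seq_increases_to u x].

Definition seq_down (S : set T) : set T :=
  [set x | exists u : nat -> T, (forall n, S (u n)) /\ seq_decreases_to u x].

End OrderConvergence.

Section POVectorSpace.
Context {R : numDomainType} (E : povsType R).

Definition positive_cone : set E := [set x | 0 <= x].

Definition monotone_complete :=
  forall (I : Type) (leI : I -> I -> Prop) (u : I -> E),
    directed leI -> net_increasing leI u -> has_ubound (range u) ->
    exists x, supremums (range u) x.

Definition countable_sup_property :=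
  forall (I : Type) (leI : I -> I -> Prop) (u : I -> E) (x : E),
    directed leI -> (forall i, positive_cone (u i)) -> positive_cone x ->
    net_increases_to leI u x ->
    exists s : nat -> I, supremums (range (u \o s)) x.

End POVectorSpace.
Arguments positive_cone {R} E.

Section CompactlySupported.
Context {R : realType} {X : topologicalType}.
Implicit Type f : X -> R.

Definition csupport f : set X := closure [set x | f x != 0].

Definition Cc : {pred X -> R} :=
  mem [set f : X -> R | continuous f /\ compact (csupport f)].

Lemma CcP f : reflect (continuous f /\ compact (csupport f)) (f \in Cc).
Proof. by apply: (iffP idP); rewrite inE. Qed.

Lemma Cc_submod_closed : submod_closed Cc.
Proof.
have supp_sub f (K : set X) : closed K -> [set x | f x != 0] `<=` K ->
    csupport f `<=` K.
  by move=> cK fK; rewrite (closure_id K).1//; exact: closureS.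
split.
  apply/CcP; split; first by move=> x; exact: cvg_cst.
  apply: (subclosed_compact (@closed_closure _ _) (@compact0 X)).
  by apply: supp_sub; [exact: closed0|move=> x /=; rewrite eqxx].
move=> a f g /CcP[cf kf] /CcP[cg kg]; apply/CcP; split.
  move=> x; have -> : a *: f + g = (fun y => a *: f y + g y) by [].
  apply: (@cvgD _ R^o); last exact: cg.
  by apply: (@cvgZ _ R^o); [exact: cvg_cst|exact: cf].
apply: (subclosed_compact (@closed_closure _ _) (compactU kf kg)).
apply: supp_sub; first by apply: closedU; exact: closed_closure.
move=> x /= afg; case: (eqVneq (f x) 0) => fx; last first.
  by left; apply: subset_closure.
right; apply: subset_closure => /=; apply: contra_neq afg => gx.
have -> : (a *: f + g) x = a *: (f x : R^o) + g x by [].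
by rewrite fx gx scaler0 addr0.
Qed.

(* [R^o] is [R] as a module over itself; it only serves to equip [X -> R] with
   its pointwise vector space structure. *)
HB.instance Definition _ :=
  GRing.isSubmodClosed.Build R (X -> R^o) Cc Cc_submod_closed.

End CompactlySupported.

Section CcSpace.
Variables (R : realType) (X : topologicalType).

Record Cc_space := CcSpace {
  Cc_fun :> X -> R^o;
  Cc_fun_subproof : Cc_fun \in (Cc : {pred X -> R^o})
}.

HB.instance Definition _ := [isSub for Cc_fun].
HB.instance Definition _ := [Choice of Cc_space by <:].
HB.instance Definition _ := [SubChoice_isSubLmodule of Cc_space by <:].

End CcSpace.

Section Subordination.
Context {R : realType} {X : topologicalType}.

Definition prec_set (f : Cc_space R X) (S : set X) :=
  (forall x, (0 : R) <= f x <= 1) /\ csupport f `<=` S.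

Definition set_prec (S : set X) (f : Cc_space R X) :=
  (forall x, (0 : R) <= f x <= 1) /\ (forall x, S x -> f x = 1).

End Subordination.

Definition borel (X : topologicalType) : set (set X) := <<s open >>.

Definition borel_measurable (X : topologicalType) d (T : measurableType d)
    (f : X -> T) :=
  forall B : set T, measurable B -> borel (f @^-1` B).

Section VectorMeasure.
Context {R : realType} {X : topologicalType} {E : povsType R}.

(* Measures are total functions on [set X]; only their values on Borel sets
   are constrained and used. *)
Record finite_measure (mu : set X -> E) : Prop := {
  finite_measure_ge0 : forall A, borel A -> positive_cone E (mu A);
  finite_measure0 : mu set0 = 0;
  finite_measure_sigma_additive : forall A : nat -> set X,
    (forall n, borel (A n)) -> trivIset setT A ->
    supremums (range (fun N => \sum_(n < N) mu (A n))) (mu (\bigcup_n A n))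
}.

Variable mu : set X -> E.

Definition inner_regular_at (A : set X) :=
  supremums [set mu K | K in [set K | compact K /\ K `<=` A]] (mu A).

Definition outer_regular_at (A : set X) :=
  infimums [set mu V | V in [set V | open V /\ A `<=` V]] (mu A).

Record regular_borel_measure : Prop := {
  regular_borel_measure_finite : finite_measure mu;
  regular_borel_measure_inner : forall V, open V -> inner_regular_at V;
  regular_borel_measure_outer : forall A, borel A -> outer_regular_at A
}.

(* [v] is the integral of the elementary function [phi], computed from some
   representation of [phi]; it does not depend on the representation. *)
Definition elementary_integral (phi : X -> R) (v : E) :=
  exists (n : nat) (r : 'I_n -> R) (D : 'I_n -> set X),
    [/\ forall i, 0 <= r i, forall i, borel (D i), trivIset setT D,
        phi = (fun x => \sum_(i < n) r i * \1_(D i) x)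
      & v = \sum_(i < n) r i *: mu (D i)].

(* [v : E] is the order integral of [f : X -> [0, oo]]. For measurable [f] and
   monotone complete [E], the integral is the infinity adjoined to [E] exactly
   when no such [v] exists; [v] does not depend on the chosen sequence. *)
Definition order_integral_is (f : X -> \bar R) (v : E) :=
  exists (phi : nat -> X -> R) (s : nat -> E),
    [/\ forall n, elementary_integral (phi n) (s n),
        forall x, seq_increases_to (fun n => (phi n x)%:E) (f x)
      & supremums (range s) v].

(* 0 by convention when the integral is infinite. *)
Definition order_integral (f : X -> \bar R) : E :=
  xget 0 [set v | order_integral_is f v].

Definition L1fun : set (X -> R) :=
  [set f : X -> R | borel_measurable f /\
           exists v, order_integral_is (fun x => `|f x|%:E) v].

Definition I_ (f : X -> R) : E :=
  order_integral (EFin \o f^\+) - order_integral (EFin \o f^\-).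

Definition bounded_borel : set (X -> R) :=
  [set f : X -> R | borel_measurable f /\ exists M : R, forall x, `|f x| <= M].

Definition ae_eq_mu (f g : X -> R) :=
  exists N, [/\ borel N, mu N = 0 & forall x, ~ N x -> f x = g x].

Definition ae_class (f : X -> R) : set (X -> R) :=
  [set g : X -> R | borel_measurable g /\ ae_eq_mu f g].

(* Both quotients are realised as sets of classes of Borel measurable
   functions modulo equality almost everywhere, which is the identification
   under which they are compared. *)
Definition L1_quotient : set (set (X -> R)) := [set ae_class f | f in L1fun].

Definition B_quotient : set (set (X -> R)) :=
  [set ae_class f | f in bounded_borel].

End VectorMeasure.

(* [m] is the modulus of [f] computed in the function space [D] with the
   pointwise order, respectively the modulus of [x] in [E]. *)
Definition is_fun_modulus (R : realType) (X : Type) (D : set (X -> R))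
    (f m : X -> R) :=
  sup_in D [set f; \- f] m.

Definition is_modulus (R : numDomainType) (E : povsType R) (x m : E) :=
  supremums [set x; - x] m.

Definition preserves_moduli (R : realType) (X : Type) (E : povsType R)
    (D : set (X -> R)) (T : (X -> R) -> E) :=
  forall f m, D f -> is_fun_modulus D f m -> is_modulus (T f) (T m).

(* Main.v *)
(* A nonnegative bounded Borel function is a uniformly convergent series
   [\sum_n c_n \1_(D n)] with [c_n >= 0] (binary expansion), so that its integral
   is the supremum of the sums of the [c_n *: mu (D n)]. Outer regularity and
   the formula for [mu V] put [mu A] in [range pi ^ (Uparrow Downarrow)]; inner
   regularity and the formula for [mu K] put [- mu A] there as well. This set is
   a cone, which gives the first two inclusions.

   Under the countable sup property nets may be replaced by sequences; moreover
   [- mu A] is then the infimum of a decreasing sequence of nonpositive elements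
   of [range pi ^ uparrow]. The partial sums of such sequences, taken
   diagonally, decrease to the value of the series, so that no third limit is
   needed. For the reverse inclusions, preservation of moduli makes a sequence
   with increasing integrals pointwise increasing, and monotone convergence
   applies. *)
From HB Require Import structures.
Require Import Defs.
From mathcomp Require Import all_boot all_order all_algebra finmap.
From mathcomp Require Import ring lra.
From mathcomp Require Import all_classical all_reals all_analysis measurable_realfun.
Import Order.TTheory GRing.Theory Num.Theory.
Import numFieldNormedType.Exports.

Set Implicit Arguments.
Unset Strict Implicit.
Unset Printing Implicit Defensive.

Local Open Scope classical_set_scope.
Local Open Scope ring_scope.

(** * Order limits in ordered vector spaces *)

Section OrderedVectorSpace.
Context {R : realType} {E : povsType R}.
Implicit Types (x y z w e : E) (a : R).

Lemma povs_leD x y z w : x <= y -> z <= w -> x + z <= y + w.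
Proof.
move=> xy zw; apply: (le_trans (povs_leD2r _ _ z xy)).
by rewrite ![y + _]addrC; exact: (povs_leD2r _ _ y zw).
Qed.

Lemma povs_lerBlDr x y z : (x - y <= z) = (x <= z + y).
Proof.
apply/idP/idP => [/(povs_leD2r _ _ y)|/(povs_leD2r _ _ (- y))]; first by rewrite subrK.
by rewrite addrK.
Qed.

Lemma povs_lerBrDr x y z : (x <= y - z) = (x + z <= y).
Proof. by rewrite -povs_lerBlDr opprK. Qed.

Lemma povs_subr_ge0 x y : (0 <= x - y) = (y <= x).
Proof. by rewrite povs_lerBrDr add0r. Qed.

Lemma povs_leN2 x y : (- x <= - y) = (y <= x).
Proof. by rewrite -(povs_subr_ge0 (- y)) opprK addrC povs_subr_ge0. Qed.

Lemma povs_oppr_le0 x : (- x <= 0) = (0 <= x).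
Proof. by rewrite -{1}oppr0 povs_leN2. Qed.

Lemma povs_oppr_ge0 x : (0 <= - x) = (x <= 0).
Proof. by rewrite -{1}oppr0 povs_leN2. Qed.

Lemma povs_lerN x y : (- x <= y) = (- y <= x).
Proof. by rewrite -{1}(opprK y) povs_leN2. Qed.

Lemma povs_addr_ge0 x y : 0 <= x -> 0 <= y -> 0 <= x + y.
Proof. by move=> x0 y0; rewrite -[0]addr0; exact: povs_leD. Qed.

Lemma povs_lerDl x y : 0 <= y -> x <= x + y.
Proof. by move=> y0; rewrite -{1}[x]addr0; exact: povs_leD. Qed.

Lemma povs_leZ a x y : 0 <= a -> x <= y -> a *: x <= a *: y.
Proof.
move=> a0; rewrite -povs_subr_ge0 => xy.
by rewrite -povs_subr_ge0 -scalerBr; exact: povs_scale_ge0.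
Qed.

Lemma povs_lerZl a b x : 0 <= x -> a <= b -> a *: x <= b *: x.
Proof.
move=> x0 ab; rewrite -povs_subr_ge0 -scalerBl.
by apply: povs_scale_ge0 => //; rewrite subr_ge0.
Qed.

Lemma povs_leZV a x y : 0 < a -> a *: x <= y -> x <= a^-1 *: y.
Proof.
move=> a0 h; have -> : x = a^-1 *: (a *: x).
  by rewrite scalerA mulVf ?scale1r// gt_eqF.
by apply: povs_leZ => //; rewrite invr_ge0 ltW.
Qed.

Lemma povs_le_double x y : x + x <= y + y -> x <= y.
Proof.
have half (w : E) : w = 2^-1 *: (w + w).
  by rewrite scalerDr -scalerDl -[2^-1]mul1r -splitr scale1r.
by move=> h; rewrite (half x) (half y); apply: povs_leZ; rewrite ?invr_ge0.
Qed.

Lemma povs_sum_ge0 (I : Type) (s : seq I) (F : I -> E) :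
  (forall i, 0 <= F i) -> 0 <= \sum_(i <- s) F i.
Proof. by move=> F0; elim/big_ind: _ => // *; exact: povs_addr_ge0. Qed.

Lemma povs_le_sum (I : Type) (s : seq I) (F G : I -> E) :
  (forall i, F i <= G i) -> \sum_(i <- s) F i <= \sum_(i <- s) G i.
Proof.
move=> FG; rewrite -povs_subr_ge0 -sumrB.
by apply: povs_sum_ge0 => i; rewrite povs_subr_ge0.
Qed.

(** Taking [a = 1 / (n + 1)] shows that all multiples [(n + 1) (x - y)] lie below [e]. This removes
    uniform error terms [a *: mu setT] from later estimates. *)
Lemma povs_archi_le x y e :
  (forall a : R, 0 < a -> x <= y + a *: e) -> x <= y.
Proof.
move=> h; suff : x - y <= 0 by rewrite povs_lerBlDr add0r.
apply: (@povs_archi _ _ (x - y) e) => n.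
have := h n.+1%:R^-1; rewrite invr_gt0 ltr0n addrC -povs_lerBlDr => /(_ isT) H.
rewrite -scaler_nat; have -> : e = n.+1%:R *: (n.+1%:R^-1 *: e).
  by rewrite scalerA mulfV ?scale1r// pnatr_eq0.
exact: povs_leZ.
Qed.

Lemma povs_le0_of_mulrn x y : (forall n : nat, x *+ n <= y) -> x <= 0.
Proof. by move=> h; apply: (@povs_archi _ _ x y) => n; exact: h. Qed.

Lemma sup_rangeP (I : Type) (u : I -> E) x :
  supremums (range u) x <->
  (forall i, u i <= x) /\ (forall z, (forall i, u i <= z) -> x <= z).
Proof.
split=> [[ux xl]|[ux xl]]; split.
- by move=> i; apply: ux; exists i.
- by move=> z uz; apply: xl => _ [i _ <-].
- by move=> _ [i _ <-].
- by move=> z uz; apply: xl => i; apply: uz; exists i.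
Qed.

Lemma inf_rangeP (I : Type) (u : I -> E) x :
  infimums (range u) x <->
  (forall i, x <= u i) /\ (forall z, (forall i, z <= u i) -> z <= x).
Proof.
split=> [[ux xl]|[ux xl]]; split.
- by move=> i; apply: ux; exists i.
- by move=> z uz; apply: xl => _ [i _ <-].
- by move=> _ [i _ <-].
- by move=> z uz; apply: xl => i; apply: uz; exists i.
Qed.

Lemma sup_inf_opp (I : Type) (u : I -> E) x :
  supremums (range u) x <-> infimums (range (fun i => - u i)) (- x).
Proof.
rewrite sup_rangeP inf_rangeP; split=> -[ux xl]; split=> [i|z zu].
- by rewrite povs_leN2.
- by rewrite -(opprK z) povs_leN2; apply: xl => i; rewrite -povs_leN2 opprK.
- by rewrite -povs_leN2.
- by rewrite -povs_leN2; apply: xl => i; rewrite povs_leN2.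
Qed.

Lemma inf_sup_opp (I : Type) (u : I -> E) x :
  infimums (range u) x <-> supremums (range (fun i => - u i)) (- x).
Proof.
rewrite sup_inf_opp opprK; suff -> : (fun i => - - u i) = u by [].
by apply/funext => i; rewrite opprK.
Qed.

End OrderedVectorSpace.

(** * Limits of monotone nets, reflection, and cones *)

Section NetClosure.
Context {R : realType} {E : povsType R}.
Implicit Types (S T : set E) (x y : E).

Lemma directed_nat : directed (fun n m : nat => (n <= m)%N).
Proof.
split.
- exact: (inhabits 0).
- by [].
- by move=> i j k; exact: leq_trans.
- by move=> i j; exists (maxn i j); rewrite leq_maxl leq_maxr.
Qed.

Lemma directed_prod (I J : Type) (leI : I -> I -> Prop) (leJ : J -> J -> Prop) :
  directed leI -> directed leJ ->
  directed (fun p q : I * J => leI p.1 q.1 /\ leJ p.2 q.2).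
Proof.
case=> [[i0] rI tI uI] [[j0] rJ tJ uJ]; split.
- exact: (inhabits (i0, j0)).
- by move=> p; split.
- by move=> p q r [pq1 pq2] [qr1 qr2]; split; [exact: tI qr1|exact: tJ qr2].
- move=> p q; have [i [pi qi]] := uI p.1 q.1; have [j [pj qj]] := uJ p.2 q.2.
  by exists (i, j).
Qed.

(** Negation turns suprema into infima. As [range pi] is symmetric, this and its three variants give
    the mirror image of each statement on iterated limits. *)
Lemma net_up_opp S T x : (forall y, S y -> T (- y)) ->
  net_up S x -> net_down T (- x).
Proof.
move=> ST [I [leI [u [dI Su [ndu ux]]]]].
exists I, leI, (fun i => - u i); split => //; first by move=> i; exact: ST.
split; last by rewrite -sup_inf_opp.
by move=> i j ij; rewrite povs_leN2; exact: ndu.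
Qed.

Lemma net_down_opp S T x : (forall y, S y -> T (- y)) ->
  net_down S x -> net_up T (- x).
Proof.
move=> ST [I [leI [u [dI Su [ndu ux]]]]].
exists I, leI, (fun i => - u i); split => //; first by move=> i; exact: ST.
split; last by rewrite -inf_sup_opp.
by move=> i j ij; rewrite povs_leN2; exact: ndu.
Qed.

Lemma seq_up_opp S T x : (forall y, S y -> T (- y)) ->
  seq_up S x -> seq_down T (- x).
Proof.
move=> ST [u [Su [ndu ux]]]; exists (fun i => - u i); split.
  by move=> i; exact: ST.
split; last by rewrite -sup_inf_opp.
by move=> i j ij; rewrite povs_leN2; exact: ndu.
Qed.

Lemma seq_down_opp S T x : (forall y, S y -> T (- y)) ->
  seq_down S x -> seq_up T (- x).
Proof.
move=> ST [u [Su [ndu ux]]]; exists (fun i => - u i); split.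
  by move=> i; exact: ST.
split; last by rewrite -inf_sup_opp.
by move=> i j ij; rewrite povs_leN2; exact: ndu.
Qed.

Lemma net_down_mono S T : S `<=` T -> net_down S `<=` net_down T.
Proof.
by move=> ST x [I [leI [u [dI Su ux]]]]; exists I, leI, u; split=> // i; exact: ST.
Qed.

Lemma seq_up_mono S T : S `<=` T -> seq_up S `<=` seq_up T.
Proof. by move=> ST x [u [Su ux]]; exists u; split=> // n; exact: ST. Qed.

Lemma seq_down_mono S T : S `<=` T -> seq_down S `<=` seq_down T.
Proof. by move=> ST x [u [Su ux]]; exists u; split=> // n; exact: ST. Qed.

Lemma net_up_self S : S `<=` net_up S.
Proof.
move=> x Sx; exists unit, (fun _ _ => True), (fun=> x); split => //.
split; first by move=> *; exact: lexx.
by apply/sup_rangeP; split=> // z /(_ tt).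
Qed.

(** Closure under negation is left out on purpose: the set of suprema of increasing nets in a
    subspace is in general not a subspace. *)
Definition cone S :=
  [/\ S 0, forall x y, S x -> S y -> S (x + y)
    & forall (a : R) x, 0 <= a -> S x -> S (a *: x)].

Lemma cone_sum S (I : Type) (s : seq I) (F : I -> E) :
  cone S -> (forall i, S (F i)) -> S (\sum_(i <- s) F i).
Proof. by move=> [S0 SD _] SF; elim/big_ind: _. Qed.

Lemma cone_setI S T : cone S -> cone T -> cone (S `&` T).
Proof.
move=> [S0 SD SZ] [T0 TD TZ]; split=> [|x y [Sx Tx] [Sy Ty]|a x a0 [Sx Tx]].
- by split.
- by split; [exact: SD|exact: TD].
- by split; [exact: SZ|exact: TZ].
Qed.

Lemma cone_nonpos : cone [set x : E | x <= 0].
Proof.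
split=> [|x y x0 y0|a x a0 x0] /=; first exact: lexx.
  by rewrite -[0]addr0; exact: povs_leD.
by rewrite -(scaler0 _ a); exact: povs_leZ.
Qed.

Lemma cone_opp S : cone S -> cone [set x | S (- x)].
Proof.
move=> [S0 SD SZ]; split=> [|x y|a x] /=; first by rewrite oppr0.
  by rewrite opprD; exact: SD.
by rewrite -scalerN; exact: SZ.
Qed.

(** The sum of two nets is indexed by pairs; its supremum is found by fixing one index and varying
    the other. *)
Lemma cone_net_up S : cone S -> cone (net_up S).
Proof.
move=> [S0 SD SZ]; split; first exact: net_up_self.
- move=> x y [I [leI [u [dI Su [ndu /sup_rangeP[ux xu]]]]]].
  move=> [J [leJ [v [dJ Sv [ndv /sup_rangeP[vy yv]]]]]].
  exists (I * J)%type, (fun p q => leI p.1 q.1 /\ leJ p.2 q.2),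
    (fun p => u p.1 + v p.2); split; first exact: directed_prod.
    by move=> p; exact: SD.
  split; first by move=> p q [pq1 pq2]; apply: povs_leD; [exact: ndu|exact: ndv].
  apply/sup_rangeP; split=> [p|z uvz]; first exact: povs_leD.
  rewrite addrC -povs_lerBrDr; apply: yv => j.
  rewrite povs_lerBrDr addrC -povs_lerBrDr; apply: xu => i.
  by rewrite povs_lerBrDr; exact: (uvz (i, j)).
(* For [a = 0] a constant net suffices; for [a > 0] upper bounds are divided by [a]. *)
- move=> a x; rewrite le_eqVlt => /predU1P[<- _|a0].
    by rewrite scale0r; exact: net_up_self.
  move=> [I [leI [u [dI Su [ndu /sup_rangeP[ux xu]]]]]].
  exists I, leI, (fun i => a *: u i); split=> //.
    by move=> i; apply: SZ => //; exact: ltW.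
  split; first by move=> i j ij; apply: povs_leZ; [exact: ltW|exact: ndu].
  apply/sup_rangeP; split=> [i|z uz]; first by apply: povs_leZ => //; exact: ltW.
  rewrite -[z]scale1r -(mulfV (lt0r_neq0 a0)) -scalerA.
  apply: povs_leZ; first exact: ltW.
  by apply: xu => i; exact: povs_leZV.
Qed.

(** Reflecting [S] reduces decreasing nets to increasing ones, so that cones and countability are
    treated for suprema only. *)
Lemma net_downE S x : net_down S x <-> net_up [set y | S (- y)] (- x).
Proof.
split; first by apply: net_down_opp => y Sy /=; rewrite opprK.
by rewrite -{2}(opprK x); apply: net_up_opp.
Qed.

Lemma cone_net_down S : cone S -> cone (net_down S).
Proof.
move=> /cone_opp/cone_net_up/cone_opp; congr cone.
apply/funext => x /=; apply/propext; exact: iff_sym (net_downE S x).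
Qed.

End NetClosure.

(** * Sequential limits and the countable sup property *)

Section Sequences.
Context {R : realType} {E : povsType R}.
Implicit Types (S : set E) (x y : E).

(* The property only concerns nets in the positive cone: it is applied to the
   translated tail [u i - u i0], [i >= i0]. *)
Lemma csp_net_up S : countable_sup_property E -> net_up S `<=` seq_up S.
Proof.
move=> csp x [I [leI [u [[[i0] rI tI uI] Su [ndu /sup_rangeP[ux xu]]]]]].
pose J := {i : I | leI i0 i}.
pose leJ (i j : J) := leI (sval i) (sval j).
have dJ : directed leJ.
  split; rewrite /leJ.
  - by apply: inhabits; exists i0.
  - by [].
  - by move=> i j k; exact: tI.
  - move=> [i i0i] [j i0j] /=; have [k [ik jk]] := uI i j.
    by exists (exist _ k (tI _ _ _ i0i ik)).
have [|||s] := csp J leJ (fun j => u (sval j) - u i0) (x - u i0) dJ.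
- by move=> [i i0i]; rewrite /positive_cone/= povs_subr_ge0; exact: ndu.
- by rewrite /positive_cone/= povs_subr_ge0.
- split; first by move=> i j ij; apply: povs_leD2r; exact: ndu.
  apply/sup_rangeP; split=> [i|z uz]; first exact: povs_leD2r.
  rewrite povs_lerBlDr; apply: xu => i; have [k [ik jk]] := uI i0 i.
  apply: (le_trans (ndu _ _ jk)).
  by rewrite -povs_lerBlDr; exact: (uz (exist _ k ik)).
move=> /sup_rangeP[_ xs].
have /choice[f fP] : forall p : I * I, exists k, leI p.1 k /\ leI p.2 k.
  by move=> [i j]; exact: uI.
(* The countable set of indices need not be a chain. The index [t n.+1] is chosen above both [t n]
   and [s n], which gives an increasing sequence with the same supremum. *)
pose t := fix t n := if n is m.+1 then f (t m, sval (s m)) else i0.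
exists (u \o t); split; first by move=> n; exact: Su.
split; first by apply/nondecreasing_seqP => n; apply: ndu; exact: (fP (t n, sval (s n))).1.
apply/sup_rangeP; split=> [n|z uz]; first exact: ux.
have : x - u i0 <= z - u i0; last first.
  by move=> /(povs_leD2r _ _ (u i0)); rewrite !subrK.
apply: xs => n; apply: povs_leD2r; apply: le_trans (uz n.+1).
by apply: ndu; exact: (fP (t n, sval (s n))).2.
Qed.

Lemma csp_net_down S : countable_sup_property E -> net_down S `<=` seq_down S.
Proof.
move=> csp x /net_downE /(csp_net_up csp) /seq_up_opp; rewrite opprK; exact.
Qed.

(** The infimum is taken in one summand at a time. A bound at a common stage suffices, because stage
    [maxn j k] lies below stage [j] in the last summand and below stage [k] in the others. *)
Lemma le_add_sum_inf (z : nat -> nat -> E) (x : nat -> E) M (w c : E) :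
  (forall n, seq_decreases_to (z n) (x n)) ->
  (forall k, w <= c + \sum_(n < M) z n k) -> w <= c + \sum_(n < M) x n.
Proof.
move=> zx; elim: M w => [|M IH] w h; first by have := h 0; rewrite !big_ord0.
rewrite big_ord_recr/= addrA [_ + x M]addrC -povs_lerBlDr.
have [ndz /inf_rangeP[_ xM]] := zx M; apply: xM => j.
rewrite povs_lerBlDr [z M j + _]addrC -povs_lerBlDr; apply: IH => k.
rewrite povs_lerBlDr; apply: (le_trans (h (maxn j k))).
rewrite big_ord_recr/= addrA; apply: povs_leD; last exact/ndz/leq_maxl.
apply: povs_leD => //; apply: povs_le_sum => n.
by apply: (zx n).1; exact: leq_maxr.
Qed.

(* Diagonal argument: the partial sums of the approximations [z n k <= 0]
   taken at stage [k = N] decrease because each new term is [<= 0]. *)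
Lemma seq_down_series S x0 (x : nat -> E) y : cone S -> S x0 ->
  (forall n, seq_down [set z | S z /\ z <= 0] (x n)) ->
  infimums (range (fun N => x0 + \sum_(n < N) x n)) y -> seq_down S y.
Proof.
move=> cS Sx0 /choice[z zP] /inf_rangeP[yx xy].
exists (fun N => x0 + \sum_(n < N) z n N); split.
  move=> N; case: (cS) => _ + _; apply=> //.
  by apply: cone_sum => // n; exact: ((zP n).1 _).1.
have ndy N k : (N <= k)%N ->
    x0 + \sum_(n < k) z n k <= x0 + \sum_(n < N) z n k.
  move=> /subnKC <-; apply: povs_leD => //; rewrite big_split_ord/=.
  rewrite -[leRHS]addr0; apply: povs_leD => //.
  rewrite -povs_oppr_ge0 -sumrN; apply: povs_sum_ge0 => n.
  by rewrite povs_oppr_ge0; exact: ((zP _).1 _).2.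
split.
  apply/nonincreasing_seqP => N; apply: (le_trans (ndy N N.+1 (leqnSn _))).
  apply: povs_leD => //; apply: povs_le_sum => n.
  by apply: (zP n).2.1; exact: leqnSn.
apply/inf_rangeP; split=> [N|w wy].
  apply: (le_trans (yx N)); apply: povs_leD => //; apply: povs_le_sum => n.
  by have /inf_rangeP[+ _] := (zP n).2.2; exact.
apply: xy => M; apply: (@le_add_sum_inf z) => [n|k]; first exact: (zP n).2.
(* Dropping the nonpositive terms from [M] on, and then going back to stage [k], can only increase
   the diagonal sum. *)
apply: (le_trans (wy (maxn k M))).
apply: (le_trans (ndy M _ (leq_maxr _ _))); apply: povs_leD => //.
by apply: povs_le_sum => n; apply: (zP n).2.1; exact: leq_maxl.
Qed.

End Sequences.

(** * Borel functions *)

Section BorelFunctions.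
Context {R : realType} {X : topologicalType}.
Implicit Types (A B : set X) (f g : X -> R).

Lemma borel_sigma_algebra : sigma_algebra [set: X] (@borel X).
Proof. exact: smallest_sigma_algebra. Qed.

Lemma borel_set0 : borel (@set0 X).
Proof. by have [] := borel_sigma_algebra. Qed.

Lemma borelC A : borel A -> borel (~` A).
Proof. by rewrite -setTD; have [_ + _] := borel_sigma_algebra; apply. Qed.

Lemma borel_bigcup (F : nat -> set X) :
  (forall n, borel (F n)) -> borel (\bigcup_n F n).
Proof. by have [_ _ +] := borel_sigma_algebra; apply. Qed.

Lemma borel_setT : borel [set: X].
Proof. by rewrite -setC0; apply: borelC; exact: borel_set0. Qed.

Lemma borelU A B : borel A -> borel B -> borel (A `|` B).
Proof.
move=> mA mB; rewrite -bigcup2E; apply: borel_bigcup => -[|[|n]]//=.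
exact: borel_set0.
Qed.

Lemma borelI A B : borel A -> borel B -> borel (A `&` B).
Proof.
move=> mA mB; rewrite -[A]setCK -[B]setCK -setCU.
by apply: borelC; apply: borelU; exact: borelC.
Qed.

Lemma borelD A B : borel A -> borel B -> borel (A `\` B).
Proof. by move=> mA mB; rewrite setDE; apply: borelI => //; exact: borelC. Qed.

Lemma borel_bigcap (F : nat -> set X) :
  (forall n, borel (F n)) -> borel (\bigcap_n F n).
Proof.
move=> mF; rewrite -[X in borel X]setCK setC_bigcap; apply: borelC.
by apply: borel_bigcup => n; exact: borelC.
Qed.

Lemma borel_open A : open A -> borel A.
Proof. exact: sub_sigma_algebra. Qed.

Lemma borel_closed A : closed A -> borel A.
Proof.
by move=> cA; rewrite -[A]setCK; apply: borelC; apply: borel_open; exact: closed_openC.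
Qed.

(* The library's measurable types are pointed; [X] need not be. *)
Section Pointed.
Variable x0 : X.

Definition pointed_at : pointedType := HB.pack X (isPointed.Build X x0).

Definition borelType : measurableType _ :=
  g_sigma_algebraType (T := pointed_at) (@open X).

Lemma borel_measurableP d (T : measurableType d) (f : X -> T) :
  borel_measurable f <-> measurable_fun [set: borelType] (f : borelType -> T).
Proof.
split=> [mf _ B mB|mf B mB]; first by rewrite setTI; exact: mf.
by have := mf measurableT B mB; rewrite setTI.
Qed.

End Pointed.

(** On an empty space every preimage is empty, so a base point may be assumed and measurability
    transferred to [borelType]. *)
Lemma borel_measurable_pt d (T : measurableType d) (f : X -> T) :
  (X -> borel_measurable f) -> borel_measurable f.
Proof.
move=> mf B mB; have [[x]|X0] := pselect (inhabited X); first exact: mf.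
suff -> : f @^-1` B = set0 by exact: borel_set0.
by apply/seteqP; split=> // x; case: X0; exact: inhabits.
Qed.

Lemma borel_measurable_comp d d' (T : measurableType d) (T' : measurableType d')
    (f : X -> T) (h : T -> T') :
  borel_measurable f -> measurable_fun setT h -> borel_measurable (h \o f).
Proof.
move=> mf mh B mB; rewrite comp_preimage; apply: mf.
by rewrite -[X in measurable X]setTI; exact: mh.
Qed.

Lemma borel_measurable_cst (c : R) : borel_measurable (fun _ : X => c).
Proof.
by apply: borel_measurable_pt => x0; apply/(borel_measurableP x0).
Qed.

Lemma borel_measurableD f g : borel_measurable f -> borel_measurable g ->
  borel_measurable (fun x => f x + g x).
Proof.
move=> mf mg; apply: borel_measurable_pt => x0; apply/(borel_measurableP x0).
by apply: measurable_funD; exact/borel_measurableP.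
Qed.

Lemma borel_measurableM f g : borel_measurable f -> borel_measurable g ->
  borel_measurable (fun x => f x * g x).
Proof.
move=> mf mg; apply: borel_measurable_pt => x0; apply/(borel_measurableP x0).
by apply: measurable_funM; exact/borel_measurableP.
Qed.

Lemma borel_measurableN f : borel_measurable f ->
  borel_measurable (fun x => - f x).
Proof.
move=> mf; apply: borel_measurable_pt => x0; apply/(borel_measurableP x0).
by apply: measurableT_comp => //; exact/borel_measurableP.
Qed.

Lemma borel_measurable_max f g : borel_measurable f -> borel_measurable g ->
  borel_measurable (fun x => Num.max (f x) (g x)).
Proof.
move=> mf mg; apply: borel_measurable_pt => x0; apply/(borel_measurableP x0).
by apply: measurable_maxr; exact/borel_measurableP.
Qed.

Lemma borel_measurable_indic A : borel A ->
  borel_measurable (\1_A : X -> R).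
Proof.
move=> mA; apply: borel_measurable_pt => x0; apply/(borel_measurableP x0).
exact: measurable_indic.
Qed.

Lemma borel_measurable_ge f (c : R) : borel_measurable f ->
  borel [set x | c <= f x].
Proof.
move=> mf; have -> : [set x | c <= f x] = f @^-1` `[c, +oo[%classic.
  by apply/seteqP; split=> x /=; rewrite in_itv/= andbT.
by apply: mf; exact: measurable_itv.
Qed.

(** The supremum may be infinite at some points, hence the extended reals; it is the tail supremum
    from index [0]. *)
Lemma borel_measurable_sup (h : nat -> X -> R) :
  (forall n, borel_measurable (h n)) ->
  borel_measurable (fun x => ereal_sup (range (fun n => (h n x)%:E))).
Proof.
move=> mh; apply: borel_measurable_pt => x0; apply/(borel_measurableP x0).
have -> : (fun x => ereal_sup (range (fun n => (h n x)%:E))) =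
    (fun x => esups (fun n => (h n x)%:E) 0).
  apply/funext => x; congr ereal_sup; apply/seteqP; split=> [_ [n _ <-]|_ [n _ <-]].
    by exists n.
  by exists n.
apply: (@measurable_fun_esups _ (borelType x0) R setT (fun n x => (h n x)%:E)) => n.
apply: measurableT_comp => //.
exact/borel_measurableP.
Qed.

Lemma borel_measurable_continuous f : continuous f -> borel_measurable f.
Proof.
move=> cf; apply: borel_measurable_pt => x0; apply/(borel_measurableP x0) => mD.
apply: (measurability _ (RGenOInfty.measurableE R)) => //.
move=> _ [_ [c ->] <-]; rewrite setTI; apply: borel_open.
by move/continuousP : cf; apply; exact: interval_open.
Qed.

Lemma bounded_borelD f g : bounded_borel f -> bounded_borel g ->
  bounded_borel (fun x => f x + g x).
Proof.
move=> [mf [M fM]] [mg [N gN]]; split; first exact: borel_measurableD.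
by exists (M + N) => x; apply: (le_trans (ler_normD _ _)); exact: lerD.
Qed.

Lemma bounded_borelN f : bounded_borel f -> bounded_borel (fun x => - f x).
Proof.
move=> [mf [M fM]]; split; first exact: borel_measurableN.
by exists M => x; rewrite normrN.
Qed.

Lemma bounded_borel_max f g : bounded_borel f -> bounded_borel g ->
  bounded_borel (fun x => Num.max (f x) (g x)).
Proof.
move=> [mf [M fM]] [mg [N gN]]; split; first exact: borel_measurable_max.
exists (Num.max M N) => x; rewrite le_max.
by case: (leP (f x) (g x)) => _; rewrite ?fM ?gN ?orbT.
Qed.

Lemma bounded_borel_indic A (c : R) : borel A ->
  bounded_borel (fun x => c * \1_A x).
Proof.
move=> mA; split.
  by apply: borel_measurableM; [exact: borel_measurable_cst|exact: borel_measurable_indic].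
exists `|c| => x; rewrite indicE normrM -[leRHS]mulr1 ler_wpM2l//.
by case: (x \in A); rewrite ?normr1 ?normr0.
Qed.

Lemma bounded_borel_cst (c : R) : bounded_borel (fun _ : X => c).
Proof. by split; [exact: borel_measurable_cst|exists `|c|]. Qed.

Lemma bounded_borel_norm f : bounded_borel f -> bounded_borel (fun x => `|f x|).
Proof.
move=> bf; suff -> : (fun x => `|f x|) = (fun x => Num.max (f x) (- f x)).
  by apply: bounded_borel_max => //; exact: bounded_borelN.
by apply/funext => x; rewrite maxrN.
Qed.

Import HBNNSimple.

Lemma elementary_approximation (E : povsType R) (mu : set X -> E) f :
  borel_measurable f -> (forall x, 0 <= f x) ->
  exists (phi : nat -> X -> R) (s : nat -> E),
    (forall n, elementary_integral mu (phi n) (s n)) /\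
    forall x, seq_increases_to (fun n => (phi n x)%:E) (f x)%:E.
Proof.
move=> mf f0; have [[x0]|X0] := pselect (inhabited X); last first.
  exists (fun _ _ => 0), (fun=> 0); split=> [n|x]; last by case: X0; exact: inhabits.
  exists 0, (fun=> 0), (fun=> set0); split=> //.
  - by move=> _; exact: borel_set0.
  - by move=> [].
  - by apply/funext => x; rewrite big_ord0.
  - by rewrite big_ord0.
have mF : measurable_fun [set: borelType x0] (EFin \o f).
  by apply: measurableT_comp => //; exact/borel_measurableP.
pose h := nnsfun_approx measurableT mF.
(* The coefficients are the finitely many values of the approximant and the sets are its level sets,
   which are disjoint. *)
pose r n (i : 'I_(#|` fset_set (range (h n))|)) := (fset_set (range (h n)))`_i.
exists (fun n x => h n x), (fun n => \sum_i r n i *: mu (h n @^-1` [set r n i])).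
split=> [n|x].
  exists _, (r n), (fun i => h n @^-1` [set r n i]); split=> //.
  - move=> i; have : r n i \in fset_set (range (h n)) by exact: mem_nth.
    rewrite in_fset_set; last exact: fimfunP.
    by rewrite inE => -[x _ <-]; exact: fun_ge0.
  - by move=> i; exact: (@measurable_sfunP _ _ (borelType x0) _ (h n)).
  - apply/trivIsetP => i j _ _ ij; apply/seteqP; split=> // x [/= hi hj].
    case/negP: ij; apply/eqP/val_inj => /=; apply/eqP.
    by rewrite -(nth_uniq 0 (ltn_ord i) (ltn_ord j) (fset_uniq _)) -/(r n i) -hi hj.
  - by apply/funext => x; rewrite fimfunEord.
have ndh : nondecreasing_seq (fun n => (h n x)%:E).
  by move=> n m nm; have /lefP := nd_nnsfun_approx measurableT mF nm; rewrite lee_fin; apply.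
split=> //.
have hf : EFin \o h ^~ x @ \oo --> (f x)%:E by apply: cvg_nnsfun_approx => //= y _; rewrite lee_fin.
have /(cvg_unique _ hf) -> // := ereal_nondecreasing_cvgn ndh.
by split; [exact: ereal_sup_ubound|move=> y hy; exact: ge_ereal_sup].
Qed.

End BorelFunctions.

(** * Integration of bounded Borel functions *)

Section Measure.
Context {R : realType} {X : topologicalType} {E : povsType R}.
Variable mu : set X -> E.
Hypothesis fmu : finite_measure mu.
Implicit Types (A B : set X).

Lemma mu_ge0 A : borel A -> 0 <= mu A.
Proof. exact: finite_measure_ge0. Qed.

(** Countable additivity is applied to [A], [B] and then empty sets: the partial sums are constant
    from two terms on, and positivity bounds the earlier ones. *)
Lemma mu_setU A B : borel A -> borel B -> A `&` B = set0 ->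
  mu (A `|` B) = mu A + mu B.
Proof.
move=> mA mB AB; have mF n : borel (bigcup2 A B n).
  by case: n => [|[|n]]//=; exact: borel_set0.
have tF : trivIset setT (bigcup2 A B).
  apply/trivIsetP => -[|[|i]] [|[|j]] _ _ //= _; rewrite ?set0I ?setI0//.
  by rewrite setIC.
have := finite_measure_sigma_additive fmu mF tF.
rewrite bigcup2E => /sup_rangeP[ub lub]; apply/eqP; rewrite eq_le; apply/andP; split.
  apply: lub => -[|[|n]].
  - by rewrite big_ord0; apply: povs_addr_ge0; exact: mu_ge0.
  - by rewrite big_ord1/=; apply: povs_lerDl; exact: mu_ge0.
  - rewrite 2!big_ord_recl/= big1 ?addr0// => i _.
    exact: finite_measure0 fmu.
by have := ub 2; rewrite 2!big_ord_recl big_ord0/= addr0.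
Qed.

Lemma mu_setID A B : borel A -> borel B -> mu A = mu (A `&` B) + mu (A `\` B).
Proof.
move=> mA mB; rewrite -mu_setU ?setUIDK//; [exact: borelI|exact: borelD|].
by apply/seteqP; split=> // x [[_ ?] []].
Qed.

Lemma le_mu A B : borel A -> borel B -> A `<=` B -> mu A <= mu B.
Proof.
move=> mA mB AB; rewrite (mu_setID mB mA).
by rewrite setIC (setIidl AB); apply: povs_lerDl; apply: mu_ge0; exact: borelD.
Qed.

(** Continuity from above, stated for lower bounds. The differences [A n]\[A n.+1] partition the
    complement of the intersection in [A 0], and their measures telescope. *)
Lemma mu_bigcap_ge (A : nat -> set X) (w : E) : (forall n, borel (A n)) ->
  (forall n, A n.+1 `<=` A n) -> (forall n, w <= mu (A n)) ->
  w <= mu (\bigcap_n A n).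
Proof.
move=> mA sA wA; pose B n := A n `\` A n.+1.
have mB n : borel (B n) by exact: borelD.
have sA' m n : (m <= n)%N -> A n `<=` A m.
  by elim: n => [|n IH]; [rewrite leqn0 => /eqP->|
    rewrite leq_eqVlt ltnS => /predU1P[->//|/IH h] x /sA /h].
have tB : trivIset setT B.
  apply: ltn_trivIset => n m nm; apply/seteqP; split=> // x [[_ nA] [/(sA' _ _ nm) Ax _]].
  exact: nA.
have UB : \bigcup_n B n = A 0 `\` \bigcap_n A n.
  apply/seteqP; split=> [x [n _ [Anx Asn]]|x [A0 nA]].
    by split; [exact: sA' Anx|move=> /(_ n.+1 I)].
  have [n nAn] : exists n, ~ A n x.
    by apply/existsNP => h; apply: nA => n _; exact: h.
  elim: n nAn => [//|n IH nAS]; have [An|/IH//] := pselect (A n x).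
  by exists n.
have mI : borel (\bigcap_n A n) by exact: borel_bigcap.
have sumB N : \sum_(n < N) mu (B n) = mu (A 0) - mu (A N).
  elim: N => [|N IH]; first by rewrite big_ord0 subrr.
  rewrite big_ord_recr/= IH (@mu_setID (A N) (A N.+1))// setIC (setIidl (sA N)).
  by rewrite -/(B N) opprD addrA subrK.
have := finite_measure_sigma_additive fmu mB tB.
rewrite UB => /sup_rangeP[_ /(_ (mu (A 0) - w))] h.
have : mu (A 0 `\` \bigcap_n A n) <= mu (A 0) - w.
  by apply: h => N; rewrite sumB; apply: povs_leD => //; rewrite povs_leN2.
rewrite (@mu_setID (A 0) (\bigcap_n A n))//.
rewrite (_ : A 0 `&` _ = \bigcap_n A n); last first.
  by apply/seteqP; split=> [x []//|x xA]; split=> //; exact: xA.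
by rewrite povs_lerBrDr [_ + w]addrC -povs_lerBrDr addrK.
Qed.

(* Simple functions are presented by lists of pairs (coefficient, set); the
   sets need not be disjoint. *)
Definition simple (s : seq (R * set X)) (x : X) : R :=
  \sum_(p <- s) p.1 * \1_(p.2) x.

Definition simple_int (s : seq (R * set X)) : E := \sum_(p <- s) p.1 *: mu p.2.

Definition borel_seq (s : seq (R * set X)) := forall p, p \in s -> borel p.2.

Lemma borel_seq_cons p s : borel_seq (p :: s) <-> borel p.2 /\ borel_seq s.
Proof.
split=> [h|[mp ms] q]; last by rewrite inE => /predU1P[->//|]; exact: ms.
by split=> [|q qs]; apply: h; rewrite inE ?eqxx// qs orbT.
Qed.

Lemma borel_seq_cat s t : borel_seq s -> borel_seq t -> borel_seq (s ++ t).
Proof. by move=> ms mt p; rewrite mem_cat => /orP[]; [exact: ms|exact: mt]. Qed.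

Lemma simple_cat s t x : simple (s ++ t) x = simple s x + simple t x.
Proof. exact: big_cat. Qed.

Lemma simple_int_cat s t : simple_int (s ++ t) = simple_int s + simple_int t.
Proof. exact: big_cat. Qed.

Lemma simple_shift (c : R) s x : simple ((c, setT) :: s) x = simple s x + c.
Proof. by rewrite /simple big_cons/= indicE in_setT mulr1 addrC. Qed.

Lemma simple_int_shift (c : R) s :
  simple_int ((c, setT) :: s) = simple_int s + c *: mu setT.
Proof. by rewrite /simple_int big_cons addrC. Qed.

Lemma borel_seq_shift (c : R) s : borel_seq s -> borel_seq ((c, setT) :: s).
Proof. by move=> ms; apply/borel_seq_cons; split; first exact: borel_setT. Qed.

Definition simple_opp (s : seq (R * set X)) := [seq (- p.1, p.2) | p <- s].

Lemma borel_seq_opp s : borel_seq s -> borel_seq (simple_opp s).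
Proof. by move=> ms _ /mapP[p ps ->] /=; exact: ms. Qed.

Lemma simple_oppE s x : simple (simple_opp s) x = - simple s x.
Proof. by rewrite /simple big_map -sumrN; apply: eq_bigr => p _; rewrite mulNr. Qed.

Lemma simple_int_opp s : simple_int (simple_opp s) = - simple_int s.
Proof. by rewrite /simple_int big_map -sumrN; apply: eq_bigr => p _; rewrite scaleNr. Qed.

(* Induction on [s]: cutting [A] along the first set [D] replaces [c] by [c + r]
   on [A `&` D] and removes the first term on [A `\` D]. *)
Lemma simple_int_ge0_on A (c : R) s : borel A -> borel_seq s ->
  (forall x, A x -> 0 <= c + simple s x) ->
  0 <= c *: mu A + \sum_(p <- s) p.1 *: mu (p.2 `&` A).
Proof.
elim: s c A => [|[r D] s IH] c A mA.
  move=> _ h; rewrite big_nil addr0.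
  (* The sign of [c] is known only if [A] has a point; otherwise [mu A = 0]. *)
  have [[x Ax]|/set0P/negP/negPn/eqP ->] := pselect (A !=set0).
    by apply: povs_scale_ge0; [have := h x Ax; rewrite /simple big_nil addr0|exact: mu_ge0].
  by rewrite (finite_measure0 fmu) scaler0.
move=> /borel_seq_cons[/= mD ms] h; rewrite big_cons/=.
have splitA B : borel B -> mu (B `&` A) = mu (B `&` (A `&` D)) + mu (B `&` (A `\` D)).
  by move=> mB; rewrite setIA classical_sets.setIDA -mu_setID//; [exact: borelI].
have H1 : 0 <= (c + r) *: mu (A `&` D) + \sum_(p <- s) p.1 *: mu (p.2 `&` (A `&` D)).
  apply: IH => [||x [Ax Dx]]; [exact: borelI|by []|].
  by have := h x Ax; rewrite /simple big_cons/= indicE mem_set// mulr1 addrA.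
have H2 : 0 <= c *: mu (A `\` D) + \sum_(p <- s) p.1 *: mu (p.2 `&` (A `\` D)).
  apply: IH => [||x [Ax Dx]]; [exact: borelD|by []|].
  by have := h x Ax; rewrite /simple big_cons/= indicE memNset// mulr0 add0r.
apply: (le_trans (povs_addr_ge0 H1 H2)); rewrite le_eqVlt; apply/orP; left; apply/eqP.
have -> : \sum_(p <- s) p.1 *: mu (p.2 `&` A) =
    \sum_(p <- s) p.1 *: mu (p.2 `&` (A `&` D)) +
    \sum_(p <- s) p.1 *: mu (p.2 `&` (A `\` D)).
  rewrite -big_split/=; apply: eq_big_seq => p ps.
  by rewrite splitA ?scalerDr//; exact: ms.
rewrite [D `&` A]setIC (mu_setID mA mD) scalerDr scalerDl.
by rewrite -!addrA; congr (_ + _); rewrite [RHS]addrCA; congr (_ + _);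
  rewrite [RHS]addrCA.
Qed.

(** Applied to differences, this gives monotonicity; hence [simple_int] depends only on the function
    and not on the list that presents it. *)
Lemma simple_int_ge0 s : borel_seq s -> (forall x, 0 <= simple s x) ->
  0 <= simple_int s.
Proof.
move=> ms s0; have := @simple_int_ge0_on setT 0 s borel_setT ms.
rewrite scale0r add0r; under eq_bigr do rewrite setIT.
by apply => x _; rewrite add0r.
Qed.

Lemma le_simple_int s t : borel_seq s -> borel_seq t ->
  (forall x, simple s x <= simple t x) -> simple_int s <= simple_int t.
Proof.
move=> ms mt st; rewrite -povs_subr_ge0 -simple_int_opp -simple_int_cat.
apply: simple_int_ge0; first by apply: borel_seq_cat => //; exact: borel_seq_opp.
by move=> x; rewrite simple_cat simple_oppE subr_ge0.
Qed.

Lemma le_simple_intD (c : R) s t : borel_seq s -> borel_seq t ->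
  (forall x, simple s x <= simple t x + c) ->
  simple_int s <= simple_int t + c *: mu setT.
Proof.
move=> ms mt st; rewrite -simple_int_shift; apply: le_simple_int => //.
  exact: borel_seq_shift.
by move=> x; rewrite simple_shift.
Qed.

End Measure.

(** * Binary expansion of bounded functions *)

Section DyadicExpansion.
Context {R : realType} {X : topologicalType}.

Lemma dyadic_half (M : R) (N : nat) :
  M / 2 ^+ N = M / 2 ^+ N.+1 + M / 2 ^+ N.+1.
Proof. by rewrite [in RHS]exprSr invfM !mulrA -splitr. Qed.

Lemma exists_dyadic_lt (M a : R) : 0 < a -> exists N, M / 2 ^+ N < a.
Proof.
move=> a0; exists (Num.bound (M / a)).
rewrite ltr_pdivrMr ?exprn_gt0// mulrC -ltr_pdivrMr//.
exact: upper_nthrootP.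
Qed.

(* Greedy binary expansion: [D n] is the set where the [n]th remainder, which
   is at most [M / 2 ^+ n], is at least half of that. *)
Lemma dyadic_expansion (g : X -> R) (M : R) : borel_measurable g ->
  (forall x, 0 <= g x <= M) ->
  exists D : nat -> set X, (forall n, borel (D n)) /\
    forall N x, 0 <= g x - \sum_(n < N) M / 2 ^+ n.+1 * \1_(D n) x <= M / 2 ^+ N.
Proof.
move=> mg gM.
pose D n (h : X -> R) := [set x | M / 2 ^+ n.+1 <= h x].
pose r := fix r n := if n is m.+1
  then (fun x => r m x - M / 2 ^+ n * \1_(D m (r m)) x) else g.
have mr n : borel_measurable (r n).
  elim: n => [//|n IH]; apply: borel_measurableD => //; apply: borel_measurableN.
  apply: borel_measurableM; first exact: borel_measurable_cst.
  by apply: borel_measurable_indic; exact: borel_measurable_ge.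
have rM n x : 0 <= r n x <= M / 2 ^+ n.
  elim: n => [|n /andP[r0 rM]]; first by rewrite expr0 divr1.
  have -> : r n.+1 x = r n x - M / 2 ^+ n.+1 * \1_(D n (r n)) x by [].
  rewrite indicE; case: (boolP (x \in D n (r n))).
    rewrite inE /D/= => h; rewrite mulr1 subr_ge0 h/= lerBlDr.
    by rewrite -dyadic_half.
  move=> /negP; rewrite inE /D/= => /negP; rewrite -ltNge => h.
  by rewrite mulr0 subr0 r0 ltW.
exists (fun n => D n (r n)); split=> [n|N x]; first exact: borel_measurable_ge.
suff -> : g x - \sum_(n < N) M / 2 ^+ n.+1 * \1_(D n (r n)) x = r N x by [].
elim: N => [|N IH]; first by rewrite big_ord0 subr0.
by rewrite big_ord_recr/= opprD addrA IH.
Qed.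

End DyadicExpansion.

(** * The integral of bounded Borel functions by upper and lower sums *)

Section BoundedIntegral.
Context {R : realType} {X : topologicalType} {E : povsType R}.
Variable mu : set X -> E.
Hypothesis fmu : finite_measure mu.
Hypothesis mcE : monotone_complete E.
Implicit Types (f g : X -> R) (s t : seq (R * set X)).

(** As with Darboux sums, [v] separates the simple functions below [f] from those above. For bounded
    Borel [f] uniform approximation makes [v] unique; [I_bint] identifies it with the order
    integral. *)
Definition is_bint f (v : E) :=
  (forall s, borel_seq s -> (forall x, simple s x <= f x) -> simple_int mu s <= v) /\
  (forall s, borel_seq s -> (forall x, f x <= simple s x) -> v <= simple_int mu s).

Definition bint f : E := xget 0 [set v | is_bint f v].

(* [expansion_seq M D N] presents the [N]th partial sum of the dyadic expansion
   of a function with values in [[- M, M]], shifted by [M] to be positive. *)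
Definition expansion_seq (M : R) (D : nat -> set X) (N : nat) :=
  (- M, setT) :: [seq ((M + M) / 2 ^+ n.+1, D n) | n <- iota 0 N].

Lemma simple_int_expansion M D N : simple_int mu (expansion_seq M D N) =
  - (M *: mu setT) + \sum_(n < N) ((M + M) / 2 ^+ n.+1) *: mu (D n).
Proof.
rewrite /simple_int big_cons big_map/= scaleNr; congr (_ + _).
by rewrite -(big_mkord xpredT (fun n => ((M + M) / 2 ^+ n.+1) *: mu (D n))) /index_iota subn0.
Qed.

Lemma simple_expansion M D N x : simple (expansion_seq M D N) x =
  - M + \sum_(n < N) ((M + M) / 2 ^+ n.+1) * \1_(D n) x.
Proof.
rewrite /simple big_cons big_map/= indicE in_setT mulr1; congr (_ + _).
by rewrite -(big_mkord xpredT (fun n => ((M + M) / 2 ^+ n.+1) * \1_(D n) x)) /index_iota subn0.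
Qed.

Lemma borel_expansion M D N : (forall n, borel (D n)) ->
  borel_seq (expansion_seq M D N).
Proof.
move=> mD; apply/borel_seq_cons; split; first exact: borel_setT.
by move=> _ /mapP[n _ ->]; exact: mD.
Qed.

Lemma bounded_borel_expansion f : bounded_borel f ->
  exists (M : R) (D : nat -> set X), [/\ 0 <= M, forall n, borel (D n) &
    forall N x, simple (expansion_seq M D N) x <= f x <=
                simple (expansion_seq M D N) x + (M + M) / 2 ^+ N].
Proof.
(* The given bound may be negative when [X] is empty; the absolute value ensures [0 <= M]. *)
move=> [mf [M0 fM0]]; pose M := `|M0|.
have fM x : - M <= f x <= M.
  by rewrite -ler_norml; apply: (le_trans (fM0 x)); exact: ler_norm.
have [||D [mD DP]] := @dyadic_expansion R X (fun x => f x + M) (M + M).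
- by apply: borel_measurableD => //; exact: borel_measurable_cst.
- by move=> x; have /andP[h1 h2] := fM x; rewrite -lerBlDr sub0r h1 lerD2r.
exists M, D; split; [exact: normr_ge0|exact: mD|move=> N x].
have /andP[h1 h2] := DP N x.
rewrite simple_expansion; set S := \sum_(n < N) _ in h1 h2 *.
by apply/andP; split; lra.
Qed.

Lemma archi_dyadic (M : R) (x y e : E) : 0 <= e ->
  (forall N, x <= y + (M / 2 ^+ N) *: e) -> x <= y.
Proof.
move=> e0 h; apply: (@povs_archi_le _ _ x y e) => a a0.
have [N MN] := exists_dyadic_lt M a0; apply: (le_trans (h N)).
by apply: povs_leD => //; apply: povs_lerZl => //; exact: ltW.
Qed.

(** The partial sums increase and lie below the integral of every simple majorant, so monotone
    completeness provides [v]. A simple minorant exceeds the [N]th partial sum by at most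
    [(M + M) / 2 ^+ N], an error which the Archimedean property removes. *)
Lemma bint_expansion_ex f : bounded_borel f ->
  exists (M : R) (D : nat -> set X) (v : E), [/\ 0 <= M, forall n, borel (D n),
    is_bint f v & supremums (range (fun N => - (M *: mu setT) +
       \sum_(n < N) ((M + M) / 2 ^+ n.+1) *: mu (D n))) v].
Proof.
move=> /bounded_borel_expansion[M [D [M0 mD fD]]].
pose u N := simple_int mu (expansion_seq M D N).
have uE : u = (fun N => - (M *: mu setT) +
       \sum_(n < N) ((M + M) / 2 ^+ n.+1) *: mu (D n)).
  by apply/funext => N; exact: simple_int_expansion.
have X0 : 0 <= mu setT by apply: mu_ge0 => //; exact: borel_setT.
have ndu : nondecreasing_seq u.
  apply/nondecreasing_seqP => N; rewrite uE big_ord_recr/= addrA.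
  apply: povs_lerDl; apply: povs_scale_ge0; last exact: mu_ge0.
  by rewrite divr_ge0 ?addr_ge0// exprn_ge0.
have uM t N : borel_seq t -> (forall x, f x <= simple t x) -> u N <= simple_int mu t.
  move=> mt ft; apply: le_simple_int => // [|x]; first exact: borel_expansion.
  by apply: le_trans (ft x); case/andP: (fD N x).
have [||v vP] := @mcE _ _ u directed_nat.
- by move=> i j ij; exact: ndu.
- exists (simple_int mu ((M + M, setT) :: expansion_seq M D 0)) => _ [N _ <-].
  apply: uM; first by apply: borel_seq_shift; exact: borel_expansion.
  by move=> x; have /andP[_] := fD 0 x; rewrite expr0 divr1 -simple_shift.
exists M, D, v; split=> //; last by rewrite -uE.
move/sup_rangeP : vP => [uv vu]; split=> t mt ft; last by apply: vu => N; exact: uM.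
apply: (@archi_dyadic (M + M) _ _ _ X0) => N.
apply: (@le_trans _ _ (u N + ((M + M) / 2 ^+ N) *: mu setT)); last exact: povs_leD.
apply: le_simple_intD => // [|x]; first exact: borel_expansion.
by apply: (le_trans (ft x)); case/andP: (fD N x).
Qed.

Lemma bintP f : bounded_borel f -> is_bint f (bint f).
Proof.
move=> /bint_expansion_ex[M [D [v [_ _ fv _]]]].
by have := @xgetPex _ 0 [set v | is_bint f v]; apply; exists v.
Qed.

Lemma bint_simple s : borel_seq s -> bint (simple s) = simple_int mu s.
Proof.
move=> ms; have : is_bint (simple s) (simple_int mu s).
  by split=> t mt st; exact: le_simple_int.
move=> sP; have [h1 h2] : is_bint (simple s) (bint (simple s)).
  by have := @xgetPex _ 0 [set v | is_bint (simple s) v]; apply; exists (simple_int mu s).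
by apply/eqP; rewrite eq_le h1 ?h2.
Qed.

(** Monotonicity and additivity of [bint] are proved from this up to multiples of [a *: mu setT],
    and [povs_archi_le] makes them exact. *)
Lemma bint_approx f (a : R) : bounded_borel f -> 0 < a ->
  exists s, [/\ borel_seq s, forall x, simple s x <= f x <= simple s x + a,
    simple_int mu s <= bint f & bint f <= simple_int mu s + a *: mu setT].
Proof.
move=> bf a0; have [M [D [M0 mD fD]]] := bounded_borel_expansion bf.
have [N MN] := exists_dyadic_lt (M + M) a0.
have mS : borel_seq (expansion_seq M D N) by exact: borel_expansion.
have fS x : simple (expansion_seq M D N) x <= f x <= simple (expansion_seq M D N) x + a.
  have /andP[-> /le_trans h] := fD N x.
  by apply: h; rewrite lerD2l ltW.
have [h1 h2] := bintP bf; exists (expansion_seq M D N); split=> //.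
  by apply: h1 => // x; case/andP: (fS x).
rewrite -simple_int_shift; apply: h2; first exact: borel_seq_shift.
by move=> x; rewrite simple_shift; case/andP: (fS x).
Qed.

Lemma le_bint f g : bounded_borel f -> bounded_borel g ->
  (forall x, f x <= g x) -> bint f <= bint g.
Proof.
move=> bf bg fg; apply: (@povs_archi_le _ _ _ _ (mu setT)) => a a0.
have [s [ms sf _ fs]] := bint_approx bf a0; apply: (le_trans fs).
apply: povs_leD => //; apply: (bintP bg).1 => // x.
by apply: le_trans (fg x); case/andP: (sf x).
Qed.

Lemma bintD f g : bounded_borel f -> bounded_borel g ->
  bint (fun x => f x + g x) = bint f + bint g.
Proof.
move=> bf bg; have bfg := bounded_borelD bf bg.
have [h1 h2] := bintP bfg.
apply/eqP; rewrite eq_le; apply/andP; split;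
  apply: (@povs_archi_le _ _ _ _ (mu setT + mu setT)) => a a0;
  have [s [ms sf s1 s2]] := bint_approx bf a0;
  have [t [mt tg t1 t2]] := bint_approx bg a0.
(* One shift by [a] for the error of [f] and one for that of [g], which together cost
   [a *: (mu setT + mu setT)]. *)
- have := h2 ((a, setT) :: (a, setT) :: s ++ t).
  rewrite !simple_int_shift simple_int_cat => h.
  apply: (@le_trans _ _ (simple_int mu s + simple_int mu t + a *: (mu setT + mu setT))).
    rewrite scalerDr addrA; apply: h.
      by do 2 apply: borel_seq_shift; exact: borel_seq_cat.
    move=> x; rewrite !simple_shift simple_cat.
    by have /andP[_ ?] := sf x; have /andP[_ ?] := tg x; lra.
  by apply: povs_leD => //; exact: povs_leD.
- apply: (le_trans (povs_leD s2 t2)); rewrite addrACA -scalerDr.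
  apply: povs_leD => //; rewrite -simple_int_cat; apply: h1.
    exact: borel_seq_cat.
  move=> x; rewrite simple_cat.
  by have /andP[? _] := sf x; have /andP[? _] := tg x; lra.
Qed.

Lemma bint_cst (c : R) : bint (fun=> c) = c *: mu setT.
Proof.
have <- : simple_int mu [:: (c, setT)] = c *: mu setT.
  by rewrite /simple_int big_seq1.
rewrite -bint_simple; last first.
  by apply/borel_seq_cons; split=> //; exact: borel_setT.
congr bint; apply/funext => x.
by rewrite /simple big_seq1/= indicE in_setT mulr1.
Qed.

Lemma bint_indic (c : R) A : borel A -> bint (fun x => c * \1_A x) = c *: mu A.
Proof.
move=> mA; have <- : simple_int mu [:: (c, A)] = c *: mu A.
  by rewrite /simple_int big_seq1.
rewrite -bint_simple; last by apply/borel_seq_cons; split.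
by congr bint; apply/funext => x; rewrite /simple big_seq1.
Qed.

Lemma bintN f : bounded_borel f -> bint (fun x => - f x) = - bint f.
Proof.
move=> bf; apply/eqP; rewrite -addr_eq0 -bintD//; last exact: bounded_borelN.
by under eq_fun do rewrite addNr; rewrite bint_cst scale0r.
Qed.

Lemma bintB f g : bounded_borel f -> bounded_borel g ->
  bint (fun x => f x - g x) = bint f - bint g.
Proof. by move=> bf bg; rewrite bintD ?bintN//; exact: bounded_borelN. Qed.

(** Two values that separate the simple functions below [f] from those above differ by at most
    [a *: mu setT] for every [a > 0], so the supremum found before is [bint mu f]. *)
Lemma bint_expansion f : bounded_borel f ->
  exists (M : R) (D : nat -> set X), [/\ 0 <= M, forall n, borel (D n) &
    supremums (range (fun N => - (M *: mu setT) +
       \sum_(n < N) ((M + M) / 2 ^+ n.+1) *: mu (D n))) (bint f)].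
Proof.
move=> bf; have [M [D [v [M0 mD [h1 h2] sv]]]] := bint_expansion_ex bf.
exists M, D; split=> //; suff -> : bint f = v by [].
have [k1 k2] := bintP bf.
apply/eqP; rewrite eq_le; apply/andP; split;
  apply: (@povs_archi_le _ _ _ _ (mu setT)) => a a0;
  have [s [ms sf s1 s2]] := bint_approx bf a0.
  apply: (le_trans s2); apply: povs_leD => //; apply: h1 => // x.
  by case/andP: (sf x).
apply: (@le_trans _ _ (simple_int mu ((a, setT) :: s))).
  apply: h2; first exact: borel_seq_shift.
  by move=> x; rewrite simple_shift; case/andP: (sf x).
by rewrite simple_int_shift; exact: povs_leD.
Qed.

(** Adding [M + M'] to [g] on [N] makes the inequality hold everywhere and leaves the integral of
    [g] unchanged. *)
Lemma le_bint_ae f g N : bounded_borel f -> bounded_borel g -> borel N ->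
  mu N = 0 -> (forall x, ~ N x -> f x <= g x) -> bint f <= bint g.
Proof.
move=> bf bg mN N0 fg; have [_ [M fM]] := bf; have [_ [M' gM]] := bg.
have -> : bint g = bint (fun x => g x + (M + M') * \1_N x).
  rewrite bintD//; last exact: bounded_borel_indic.
  by rewrite bint_indic// N0 scaler0 addr0.
apply: le_bint => // [|x].
  by apply: bounded_borelD => //; exact: bounded_borel_indic.
have := fM x; have := gM x; rewrite !ler_norml => /andP[? ?] /andP[? ?].
have [Nx|Nx] := pselect (N x); rewrite indicE.
  by rewrite mem_set// mulr1; lra.
by rewrite memNset// mulr0 addr0; exact: fg.
Qed.

(* On the decreasing sets [A n = {f_ n < f - a}], which shrink to a null set,
   [f] is controlled by a constant; elsewhere [f <= f_ n + a]. *)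
Lemma bint_le_sup (f_ : nat -> X -> R) f N (u : E) :
  (forall n, bounded_borel (f_ n)) -> (forall n x, f_ n x <= f_ n.+1 x) ->
  bounded_borel f -> borel N -> mu N = 0 ->
  (forall x, ~ N x -> forall a : R, 0 < a -> exists n, f x - a <= f_ n x) ->
  (forall n, bint (f_ n) <= u) -> bint f <= u.
Proof.
move=> bf_ ndf bf mN N0 ff u_; apply: (@povs_archi_le _ _ _ _ (mu setT)) => a a0.
pose A n := ~` [set x | 0 <= f_ n x - f x + a].
have mA n : borel (A n).
  apply: borelC; apply: borel_measurable_ge.
  apply: borel_measurableD; last exact: borel_measurable_cst.
  by apply: borel_measurableD; [exact: (bf_ n).1|apply: borel_measurableN; exact: bf.1].
have AE n x : A n x <-> f_ n x < f x - a.
  by rewrite /A/=; split=> [/negP|h]; [rewrite -ltNge|apply/negP; rewrite -ltNge]; lra.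
have sA n : A n.+1 `<=` A n.
  by move=> x /AE h; apply/AE; apply: le_lt_trans h; exact: ndf.
have IA : \bigcap_n A n `<=` N.
  move=> x Ax; apply: contrapT => /ff/(_ a a0)[n]; have /AE := Ax n I.
  by rewrite ltNge => /negP.
have [_ [M fM]] := bf; have [_ [M' fM']] := bf_ 0.
(* [C] bounds [f - f_ 0], hence every [f - f_ n]; the summand [1] makes it invertible. *)
pose C := `|M| + `|M'| + 1.
have C0 : 0 < C by rewrite ltr_wpDl// addr_ge0.
(* Integrating [f <= C * \1_(A n) + a + f_ n] and solving for [mu (A n)] gives a lower bound
   independent of [n], which passes to the null intersection. *)
have key n : C^-1 *: (bint f - u - a *: mu setT) <= mu (A n).
  have -> : mu (A n) = C^-1 *: (C *: mu (A n)) by rewrite scalerA mulVf ?scale1r// gt_eqF.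
  apply: povs_leZ; first by rewrite invr_ge0 ltW.
  rewrite !povs_lerBlDr.
  have bC : bounded_borel (fun x => C * \1_(A n) x) by exact: bounded_borel_indic.
  have bca : bounded_borel (fun x => C * \1_(A n) x + a).
    by apply: bounded_borelD => //; exact: bounded_borel_cst.
  have : bint f <= bint (fun x => C * \1_(A n) x + a + f_ n x).
    apply: le_bint => // [|x]; first exact: bounded_borelD.
    rewrite indicE; have [/[dup] Ax /AE h|Ax] := pselect (A n x).
      rewrite mem_set// mulr1.
      have f0n : f_ 0 x <= f_ n x.
        by elim: n {bC bca Ax h} => // n IH; exact: le_trans (ndf n x).
      have := fM x; have := fM' x; rewrite !ler_norml => /andP[? ?] /andP[? ?].
      have := ler_norm M; have := ler_norm M'; rewrite /C; lra.
    rewrite memNset// mulr0 add0r.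
    have : ~ f_ n x < f x - a by move=> /AE.
    by move=> /negP; rewrite -leNgt; lra.
  rewrite bintD// bintD//; last exact: bounded_borel_cst.
  rewrite bint_indic// bint_cst => /le_trans; apply.
  by apply: povs_leD => //; exact: u_.
have := mu_bigcap_ge fmu mA sA key.
have : mu (\bigcap_n A n) <= 0.
  by rewrite -N0; apply: le_mu => //; exact: borel_bigcap.
move=> h0 /le_trans/(_ h0) /(povs_leZ (ltW C0)).
by rewrite scalerA mulfV ?gt_eqF// scale1r scaler0 !povs_lerBlDr add0r addrC.
Qed.

End BoundedIntegral.

(** * Comparison with the order integral, moduli and monotone limits *)

Section OrderIntegral.
Context {R : realType} {X : topologicalType} {E : povsType R}.
Variable mu : set X -> E.
Hypothesis fmu : finite_measure mu.
Hypothesis mcE : monotone_complete E.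
Implicit Types (f g : X -> R) (s t : seq (R * set X)).

Lemma bounded_borel_simple s : borel_seq s -> bounded_borel (simple s).
Proof.
elim: s => [_|[r D] s IH /borel_seq_cons[/= mD /IH bs]].
  suff -> : simple [::] = (fun _ : X => 0 : R) by exact: bounded_borel_cst.
  by apply/funext => x; rewrite /simple big_nil.
have -> : simple ((r, D) :: s) = (fun x => r * \1_D x + simple s x).
  by apply/funext => x; rewrite /simple big_cons.
by apply: bounded_borelD => //; exact: bounded_borel_indic.
Qed.

Lemma elementary_simple (phi : X -> R) (v : E) : elementary_integral mu phi v ->
  exists s, [/\ borel_seq s, phi = simple s & v = simple_int mu s].
Proof.
move=> [n [r [D [r0 mD _ -> ->]]]].
exists [seq (r i, D i) | i <- index_enum 'I_n]; split.
- by move=> _ /mapP[i _ ->]; exact: mD.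
- by apply/funext => x; rewrite /simple big_map.
- by rewrite /simple_int big_map.
Qed.

Lemma elementary_bint (phi : X -> R) (v : E) : elementary_integral mu phi v ->
  bounded_borel phi /\ v = bint mu phi.
Proof.
move=> /elementary_simple[s [ms -> ->]]; split; first exact: bounded_borel_simple.
by rewrite bint_simple.
Qed.

Lemma seq_increases_EFin (u : nat -> R) (l : R) :
  seq_increases_to (fun n => (u n)%:E) l%:E ->
  [/\ forall n, u n <= u n.+1, forall n, u n <= l &
      forall a : R, 0 < a -> exists n, l - a <= u n].
Proof.
move=> [ndu [ul lu]]; split=> [n|n|a a0].
- by rewrite -lee_fin; apply: ndu; exact: leqnSn.
- by rewrite -lee_fin; apply: ul; exists n.
- apply: contrapT => h.
  have : (l%:E <= (l - a)%:E)%E.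
    apply: lu => _ [n _ <-]; rewrite lee_fin leNgt; apply/negP => /ltW ln.
    by apply: h; exists n.
  by rewrite lee_fin; lra.
Qed.

(** Monotone convergence with empty exceptional set: every approximating sequence has the same
    supremum of integrals, so the order integral of a bounded function is well defined. *)
Lemma sup_elementary_bint f (phi : nat -> X -> R) (s : nat -> E) :
  bounded_borel f -> (forall n, elementary_integral mu (phi n) (s n)) ->
  (forall x, seq_increases_to (fun n => (phi n x)%:E) (f x)%:E) ->
  supremums (range s) (bint mu f).
Proof.
move=> bf phis phif; have bphi n : bounded_borel (phi n) by have [] := elementary_bint (phis n).
have sE n : s n = bint mu (phi n) by have [] := elementary_bint (phis n).
apply/sup_rangeP; split=> [n|z sz].
  rewrite sE; apply: le_bint => // x.
  by have [] := seq_increases_EFin (phif x).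
apply: (@bint_le_sup _ _ _ _ fmu mcE phi f set0) => //.
- by move=> n x; have [] := seq_increases_EFin (phif x).
- exact: borel_set0.
- exact: finite_measure0 fmu.
- by move=> x _; have [] := seq_increases_EFin (phif x).
- by move=> n; rewrite -sE.
Qed.

Lemma order_integral_is_bint f : bounded_borel f -> (forall x, 0 <= f x) ->
  order_integral_is mu (EFin \o f) (bint mu f).
Proof.
move=> bf f0; have [phi [s [phis phif]]] := elementary_approximation mu bf.1 f0.
by exists phi, s; split=> //; exact: sup_elementary_bint phif.
Qed.

Lemma order_integral_bint f : bounded_borel f -> (forall x, 0 <= f x) ->
  order_integral mu (EFin \o f) = bint mu f.
Proof.
move=> bf f0; apply: xget_unique; first exact: order_integral_is_bint.
move=> v [phi [s [phis phif sv]]].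
by apply: (is_subset1_supremums sv); exact: sup_elementary_bint phif.
Qed.

Lemma I_bint f : bounded_borel f -> I_ mu f = bint mu f.
Proof.
move=> bf; have b0 := @bounded_borel_cst R X 0.
have bp : bounded_borel f^\+ by apply: bounded_borel_max.
have bn : bounded_borel f^\- by apply: bounded_borel_max => //; exact: bounded_borelN.
rewrite /I_ (order_integral_bint bp (funrpos_ge0 f)).
rewrite (order_integral_bint bn (funrneg_ge0 f)).
rewrite -bintB//; congr bint; exact: funrposBneg.
Qed.

Lemma bounded_borel_L1fun : @bounded_borel R X `<=` L1fun mu.
Proof.
move=> f bf; split; first exact: bf.1.
exists (bint mu (fun x => `|f x|)); apply: order_integral_is_bint => //.
exact: bounded_borel_norm.
Qed.

(* Since [2 (f \max g) = f + g + |f - g|], preserving moduli means preserving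
   finite suprema. *)
Lemma bint_max_le f g (z : E) : preserves_moduli (L1fun mu) (I_ mu) ->
  bounded_borel f -> bounded_borel g -> bint mu f <= z -> bint mu g <= z ->
  bint mu (fun x => Num.max (f x) (g x)) <= z.
Proof.
move=> pm bf bg fz gz; pose h x := f x - g x.
have bh : bounded_borel h by apply: bounded_borelD => //; exact: bounded_borelN.
have bnh : bounded_borel (fun x => `|h x|) by exact: bounded_borel_norm.
(* The pointwise absolute value of [h] is its modulus within [L1fun mu]. *)
have [|_] := pm h (fun x => `|h x|) (bounded_borel_L1fun bh).
  split; first exact: bounded_borel_L1fun.
    by move=> _ [->|->]; apply/lefP => x /=; rewrite ?ler_norm// -normrN ler_norm.
  move=> k _ hk; apply/lefP => x; rewrite ler_norml.
  have /lefP/(_ x) h1 := hk h (or_introl erefl).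
  by have /lefP/(_ x)/= h2 := hk (\- h) (or_intror erefl); rewrite h1 andbT lerNl.
rewrite !I_bint// => hw.
(* Since both integrals are at most [z], the right-hand side dominates the integrals of [h] and of
   [- h], hence their modulus. *)
have {hw} : bint mu (fun x => `|h x|) <= z + z - (bint mu f + bint mu g).
  apply: hw => _ [->|->]; rewrite povs_lerBrDr bintB//.
    by rewrite addrACA addNr addr0; exact: povs_leD.
  by rewrite opprB [_ - _]addrC addrACA addNr add0r; exact: povs_leD.
have bm : bounded_borel (fun x => Num.max (f x) (g x)) by exact: bounded_borel_max.
rewrite povs_lerBrDr -bintD// -bintD//; last exact: bounded_borelD.
rewrite (_ : (fun x => _) = (fun x => Num.max (f x) (g x) + Num.max (f x) (g x))).
  by rewrite bintD// => /povs_le_double.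
apply/funext => x; rewrite /h; case: (leP (f x) (g x)) => fg.
  by rewrite ler0_norm ?subr_le0//; ring.
by rewrite gtr0_norm ?subr_gt0//; ring.
Qed.

(* The running maxima [g n] of the integrands have the integrals [u n], because
   [I_] preserves maxima; they increase to a function that is finite almost
   everywhere by the Archimedean property, and this limit is bounded almost
   everywhere because [L1_quotient mu = B_quotient mu]. *)
Lemma seq_up_I_bounded : preserves_moduli (L1fun mu) (I_ mu) ->
  L1_quotient mu = B_quotient mu ->
  seq_up [set I_ mu f | f in bounded_borel] `<=` [set I_ mu f | f in bounded_borel].
Proof.
move=> pm L1B x [u [uB [ndu /sup_rangeP[ux xu]]]].
have /choice[f fP] : forall n, exists f, bounded_borel f /\ bint mu f = u n.
  by move=> n; have [f bf <-] := uB n; exists f; rewrite I_bint.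
pose g := fix g n : X -> R :=
  if n is m.+1 then (fun y => Num.max (g m y) (f m.+1 y)) else f 0.
have bg n : bounded_borel (g n).
  elim: n => [|n IH]; first exact: (fP 0).1.
  by apply: bounded_borel_max => //; exact: (fP n.+1).1.
have gu n : bint mu (g n) = u n.
  elim: n => [|n IH]; first exact: (fP 0).2.
  apply/eqP; rewrite eq_le; apply/andP; split.
    apply: bint_max_le => //; [exact: (fP n.+1).1| |].
      by rewrite IH; apply: ndu; exact: leqnSn.
    by rewrite (fP n.+1).2.
  rewrite -(fP n.+1).2; apply: le_bint => //; first exact: (fP n.+1).1.
  by move=> y; rewrite /= le_max lexx orbT.
(* Subtracting [g 0] makes the sequence start at [0], so that its limit is nonnegative. *)
pose h n y := g n y - g 0 y.
have bh n : bounded_borel (h n) by apply: bounded_borelD => //; exact: bounded_borelN.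
have ndh n y : h n y <= h n.+1 y by rewrite lerD2r /= le_max lexx.
have h0 y : h 0 y = 0 by rewrite /h subrr.
have hu n : bint mu (h n) = u n - u 0 by rewrite bintB// !gu.
have hx n : bint mu (h n) <= x - u 0 by rewrite hu; exact: povs_leD2r.
pose F y := ereal_sup (range (fun n => (h n y)%:E)).
have F0 y : (0 <= F y)%E by apply: ereal_sup_ubound; exists 0 => //=; rewrite h0.
have hF (y : X) (c a : R) : (c%:E <= F y)%E -> 0 < a -> exists n, c - a <= h n y.
  move=> cF a0; apply: contrapT => nh.
  have : (F y <= (c - a)%:E)%E.
    apply: ge_ereal_sup => _ [n _ <-]; rewrite lee_fin leNgt; apply/negP => /ltW ch.
    by apply: nh; exists n.
  by move=> /(le_trans cF); rewrite lee_fin; lra.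
have mF : borel_measurable F by apply: borel_measurable_sup => n; exact: (bh n).1.
pose N := F @^-1` [set +oo%E].
have mN : borel N by apply: mF; exact: emeasurable_set1.
(* For each [m] the function [m * \1_N] lies below the limit of the [h n], so [m] times [mu N] is at
   most [x - u 0]. *)
have muN : mu N = 0.
  apply/eqP; rewrite eq_le; apply/andP; split; last exact: mu_ge0.
  apply: (@povs_le0_of_mulrn _ _ _ (x - u 0)) => m.
  rewrite -scaler_nat -bint_indic//.
  apply: (@bint_le_sup _ _ _ _ fmu mcE h _ set0) => //.
  - exact: bounded_borel_indic.
  - exact: borel_set0.
  - exact: finite_measure0 fmu.
  move=> y _ a a0; rewrite indicE; have [Ny|Ny] := pselect (N y).
    rewrite mem_set// mulr1; apply: hF => //.
    by rewrite (Ny : F y = +oo%E) leey.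
  by rewrite memNset// mulr0; exists 0; rewrite h0 sub0r oppr_le0 ltW.
(* [fine] sends infinity to [0]: thus [k] is real valued, agrees with [F] off [N], and lies below
   [F] everywhere. *)
pose k y := fine (F y).
have k0 y : 0 <= k y by exact: fine_ge0.
have kE y : ~ N y -> (k y)%:E = F y.
  move=> Ny; rewrite /k fineK// ge0_fin_numE//.
  by rewrite ltey; apply/eqP.
have kF y : ((k y)%:E <= F y)%E.
  have [Ny|/kE->//] := pselect (N y).
  by rewrite (Ny : F y = +oo%E) leey.
have mk : borel_measurable k by apply: borel_measurable_comp => //; exact: fine_measurable.
(* The integrals of elementary functions increasing to [k] are bounded by [x - u 0], so monotone
   completeness gives a finite integral. *)
have L1k : L1fun mu k.
  split=> //; have [phi [s [phis phik]]] := elementary_approximation mu mk k0.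
  have bphi n : bounded_borel (phi n) by have [] := elementary_bint (phis n).
  have sE n : s n = bint mu (phi n) by have [] := elementary_bint (phis n).
  have [||v sv] := @mcE _ _ s directed_nat.
  - suff nds : nondecreasing_seq s by move=> i j ij; exact: nds.
    apply/nondecreasing_seqP => n; rewrite !sE; apply: le_bint => // y.
    by have [] := seq_increases_EFin (phik y).
  - exists (x - u 0) => _ [n _ <-]; rewrite sE.
    apply: (@bint_le_sup _ _ _ _ fmu mcE h _ set0) => //.
    + exact: borel_set0.
    + exact: finite_measure0 fmu.
    move=> y _ a a0; apply: hF => //; apply: le_trans (kF y).
    by rewrite lee_fin; have [] := seq_increases_EFin (phik y).
  exists v, phi, s; split=> // y.
  by rewrite ger0_norm.
have [b bb bk] : B_quotient mu (ae_class mu k) by rewrite -L1B; exists k.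
(* [k] belongs to its own class, which is that of the bounded function [b]; hence [b = k] off a null
   set [N']. *)
have [_ [N' [mN' N'0 bkE]]] : ae_class mu b k.
  rewrite bk; split=> //; exists set0; split=> //; first exact: borel_set0.
  exact: finite_measure0 fmu.
have bx : bint mu b = x - u 0.
  apply/eqP; rewrite eq_le; apply/andP; split.
    apply: (@bint_le_sup _ _ _ _ fmu mcE h _ N') => // y N'y a a0.
    by apply: hF => //; rewrite bkE.
  rewrite povs_lerBlDr; apply: xu => n; rewrite -povs_lerBlDr -hu.
  (* The union of the exceptional sets is written disjointly, so that additivity gives it measure
     [0]. *)
  have mD : borel (N' `\` N) by exact: borelD.
  apply: (@le_bint_ae _ _ _ _ fmu mcE _ _ (N `|` (N' `\` N))) => //.
  - exact: borelU.
  - rewrite mu_setU// ?muN ?add0r; last by apply/seteqP; split=> // y [? []].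
    apply/eqP; rewrite eq_le mu_ge0// andbT -N'0.
    by apply: le_mu => // y [].
  move=> y NN'; have Ny : ~ N y by move=> Ny; apply: NN'; left.
  have N'y : ~ N' y by move=> N'y; apply: NN'; right.
  rewrite bkE// -lee_fin kE//; apply: ereal_sup_ubound.
  by exists n.
exists (fun y => b y + g 0 y); first exact: bounded_borelD.
rewrite I_bint; last exact: bounded_borelD.
by rewrite bintD// bx gu subrK.
Qed.

End OrderIntegral.

(** * Values approximated by [C_c(X)] *)

Section CompactSupport.
Context {R : realType} {X : topologicalType}.
Implicit Types f g : Cc_space R X.

Lemma Cc_continuous f : continuous (f : X -> R).
Proof. by have /CcP[] := Cc_fun_subproof f. Qed.

Lemma Cc_compact f : compact (csupport f).
Proof. by have /CcP[] := Cc_fun_subproof f. Qed.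

Lemma csupport_notin (f : X -> R) x : ~ csupport f x -> f x = 0.
Proof. by move=> fx; apply: contrapT => /eqP f0; apply: fx; exact: subset_closure. Qed.

Lemma csupport_sub (f : X -> R) (K : set X) : closed K ->
  (forall x, f x != 0 -> K x) -> csupport f `<=` K.
Proof. by move=> cK fK; rewrite (closure_id K).1//; exact: closureS. Qed.

Lemma Cc_bounded_borel f : bounded_borel (f : X -> R).
Proof.
split; first by apply: borel_measurable_continuous; exact: Cc_continuous.
have : compact ((f : X -> R) @` csupport f).
  by apply: continuous_compact; [exact/continuous_subspaceT/Cc_continuous|exact: Cc_compact].
move=> /compact_bounded[M [_ /(_ (M + 1))]]; rewrite ltrDl ltr01 => /(_ isT) fM.
exists `|M + 1| => x; have [fx|/csupport_notin->] := pselect (csupport f x).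
  by apply: le_trans (ler_norm _); apply: fM; exists x.
by rewrite normr0.
Qed.

Lemma Cc_max f g : exists h : Cc_space R X,
  (forall x, h x = Num.max (f x : R) (g x)) /\
  csupport h `<=` csupport f `|` csupport g.
Proof.
pose h x := Num.max (f x : R) (g x).
have hs : csupport h `<=` csupport f `|` csupport g.
  apply: csupport_sub; first by apply: closedU; exact: closed_closure.
  move=> x; apply: contra_neqP => /not_orP[/csupport_notin f0 /csupport_notin g0].
  by rewrite /h f0 g0 maxxx.
have hC : h \in (Cc : {pred X -> R^o}).
  apply/CcP; split.
    by move=> x; apply: continuous_max; exact: Cc_continuous.
  apply: subclosed_compact hs; first exact: closed_closure.
  by apply: compactU; exact: Cc_compact.
by exists (CcSpace hC).
Qed.

Lemma Cc_min f g : exists h : Cc_space R X,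
  forall x, h x = Num.min (f x : R) (g x).
Proof.
have [h [hE _]] := Cc_max (- f) (- g); exists (- h) => x.
have -> : (- h) x = - (h x : R) by [].
by rewrite hE -oppr_min opprK.
Qed.

End CompactSupport.

(** * Regularity and the position of integrals relative to the range of the operator *)

Section Representation.
Context {R : realType} {X : topologicalType} {E : povsType R}.
Variables (pi : {linear Cc_space R X -> E}) (mu : set X -> E).
Hypothesis hausX : hausdorff_space X.
Hypothesis mcE : monotone_complete E.
Hypothesis pi_ge0 : forall f : Cc_space R X, (forall x, (0 : R) <= f x) -> 0 <= pi f.
Hypothesis mu_regular : regular_borel_measure mu.
Hypothesis mu_inner : forall A, borel A -> inner_regular_at mu A.
Hypothesis pi_mu : forall f : Cc_space R X, pi f = I_ mu f.
Hypothesis mu_open : forall V, open V ->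
  sup_in (positive_cone E) [set pi f | f in [set f | prec_set f V]] (mu V).
Hypothesis mu_compact : forall K, compact K ->
  inf_in (positive_cone E) [set pi f | f in [set f | set_prec K f]] (mu K).

Let fmu : finite_measure mu := regular_borel_measure_finite mu_regular.

Lemma pi_le (f g : Cc_space R X) : (forall x, (f x : R) <= g x) -> pi f <= pi g.
Proof.
move=> fg; rewrite -povs_subr_ge0 -linearB; apply: pi_ge0 => x.
by have -> : (g - f) x = (g x : R) - f x by []; rewrite subr_ge0.
Qed.

Lemma cone_range_pi : cone (range pi).
Proof.
split; first by exists 0 => //; rewrite linear0.
  by move=> _ _ [f _ <-] [g _ <-]; exists (f + g) => //; rewrite linearD.
by move=> a _ _ [f _ <-]; exists (a *: f) => //; rewrite linearZ.
Qed.

Lemma range_piN y : range pi y -> range pi (- y).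
Proof. by move=> [f _ <-]; exists (- f) => //; rewrite linearN. Qed.

(** The functions subordinate to [V] are directed under pointwise maxima, whose supports stay in the
    union of the two supports. *)
Lemma net_up_mu_open V : open V -> net_up (range pi) (mu V).
Proof.
move=> oV; have [_ ub lub] := mu_open oV.
pose I := {f : Cc_space R X | prec_set f V}.
exists I, (fun f g : I => forall x, (sval f x : R) <= sval g x), (fun f => pi (sval f)).
have prec0 : prec_set (0 : Cc_space R X) V.
  split=> [x|]; first by have -> : (0 : Cc_space R X) x = (0 : R) by []; rewrite lexx ler01.
  apply: (@subset_trans _ set0) => //; apply: csupport_sub; first exact: closed0.
  by move=> x; rewrite eqxx.
split=> //.
- split.
  + by apply: inhabits; exists 0.
  + by move=> f x.
  + by move=> f g h fg gh x; exact: le_trans (gh x).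
  + move=> [f [f01 fV]] [g [g01 gV]] /=; have [h [hE hs]] := Cc_max f g.
    have hV : prec_set h V.
      split=> [x|]; last by apply: (subset_trans hs); rewrite subUset.
      by rewrite hE; case: (leP (f x : R) (g x)).
    exists (exist _ h hV); split=> x /=.
      by rewrite hE le_max lexx.
    by rewrite hE le_max lexx orbT.
- split; first by move=> f g fg; exact: pi_le.
  apply/sup_rangeP; split=> [[f fV]|z zP]; first by apply: ub; exists f.
  apply: lub; last by move=> _ [f fV <-]; exact: (zP (exist _ f fV)).
  (* [mu_open] compares [mu V] with positive upper bounds only; the zero function is subordinate to
     [V], so every upper bound is positive. *)
  by have := zP (exist _ 0 prec0); rewrite /= linear0.
Qed.

(* If no [f] satisfies [set_prec K f], then [mu K] is the infimum of the empty
   set in the positive cone, hence dominates [2 mu K] and vanishes. *)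
Lemma net_up_mu_compact K : compact K -> net_up (range pi) (- mu K).
Proof.
move=> cK; have [K0 lb glb] := mu_compact cK.
have [[f0 f0K]|noK] := pselect (exists f : Cc_space R X, set_prec K f); last first.
  suff -> : mu K = 0.
    by rewrite oppr0; apply: net_up_self; have [] := cone_range_pi.
  apply/eqP; rewrite eq_le; apply/andP; split; last exact: K0.
  have := glb (mu K + mu K); rewrite -povs_lerBrDr subrr; apply.
    exact: povs_addr_ge0.
  by move=> _ [f fK <-]; case: noK; exists f.
pose I := {f : Cc_space R X | set_prec K f}.
pose leI (f g : I) := forall x, (sval g x : R) <= sval f x.
have dI : directed leI.
  split.
  + by apply: inhabits; exists f0.
  + by move=> f x.
  + by move=> f g h fg gh x; exact: le_trans (fg x).
  + move=> [f [f01 fK]] [g [g01 gK]] /=; have [h hE] := Cc_min f g.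
    have hK : set_prec K h.
      split=> x; rewrite hE; first by case: (leP (f x : R) (g x)).
      by move=> Kx; rewrite fK// gK// minxx.
    exists (exist _ h hK); split=> x /=; rewrite hE.
      by rewrite ge_min lexx.
    by rewrite ge_min lexx orbT.
have ndI : net_increasing leI (fun f : I => - pi (sval f)).
  by move=> f g fg; rewrite povs_leN2; exact: pi_le.
have pos (f : I) : 0 <= pi (sval f).
  by apply: pi_ge0 => x; have /andP[] := (svalP f).1 x.
(* [mu_compact] compares [mu K] with positive lower bounds only. Monotone completeness gives the
   infimum [- v] in [E]; as [0] is a lower bound, [- v] is positive and therefore equals [mu K]. *)
have [|v vP] := mcE dI ndI.
  by exists 0 => _ [f _ <-]; rewrite povs_oppr_le0.
suff Kv : mu K = - v.
  exists I, leI, (fun f => - pi (sval f)); split=> //.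
    by move=> f; apply: range_piN; exists (sval f).
  by rewrite Kv opprK.
have /sup_rangeP[uv vu] := vP.
have vl (f : I) : - v <= pi (sval f) by rewrite povs_lerN; exact: uv.
apply/eqP; rewrite eq_le; apply/andP; split.
  rewrite -(opprK (mu K)) povs_leN2; apply: vu => f; rewrite povs_leN2.
  by apply: lb; exists (sval f) => //; exact: svalP.
apply: glb; last by move=> _ [f fK <-]; exact: (vl (exist _ f fK)).
by rewrite /positive_cone/= povs_oppr_ge0; apply: vu => f; rewrite povs_oppr_le0.
Qed.

(** Outer regularity: the open sets containing [A] are directed under intersection. *)
Lemma net_down_mu A : borel A -> net_down (net_up (range pi)) (mu A).
Proof.
move=> mA; have outA := regular_borel_measure_outer mu_regular mA.
exists {V | open V /\ A `<=` V}, (fun V W => sval W `<=` sval V),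
  (fun V => mu (sval V)); split.
- split.
  + by apply: inhabits; exists setT; split=> //; exact: openT.
  + by move=> V x.
  + by move=> U V W UV VW; exact: subset_trans UV.
  + move=> [V [oV AV]] [W [oW AW]] /=.
    have VW : open (V `&` W) /\ A `<=` V `&` W.
      by split; [exact: openI|move=> x Ax; split; [exact: AV|exact: AW]].
    by exists (exist _ (V `&` W) VW); split=> x [].
- by move=> [V [oV AV]]; exact: net_up_mu_open.
- split.
    move=> [V [oV AV]] [W [oW AW]] /= WV.
    by apply: (le_mu fmu) => //; exact: borel_open.
  case: outA => lb glb; apply/inf_rangeP; split=> [[V VP]|z zV].
    by apply: lb; exists V.
  by apply: glb => _ [V VP <-]; exact: (zV (exist _ V VP)).
Qed.

(** Inner regularity: the compact subsets of [A] are directed under union, and are Borel because [X]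
    is Hausdorff. The sign of the approximants is recorded for use in [seq_down_series]. *)
Lemma net_down_oppmu A : borel A ->
  net_down [set z | net_up (range pi) z /\ z <= 0] (- mu A).
Proof.
move=> mA; have inA := mu_inner mA.
have mK (K : set X) : compact K -> borel K.
  by move=> cK; apply: borel_closed; exact: compact_closed.
exists {K | compact K /\ K `<=` A}, (fun K L => sval K `<=` sval L),
  (fun K => - mu (sval K)); split.
- split.
  + by apply: inhabits; exists set0; split=> //; exact: compact0.
  + by move=> V x.
  + by move=> U V W UV VW; exact: subset_trans VW.
  + move=> [V [oV AV]] [W [oW AW]] /=.
    have VW : compact (V `|` W) /\ V `|` W `<=` A.
      by split; [exact: compactU|move=> x [/AV|/AW]].
    by exists (exist _ (V `|` W) VW); split=> x; [left|right].
- move=> [V [oV AV]] /=; split; first exact: net_up_mu_compact.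
  by rewrite povs_oppr_le0; apply: (mu_ge0 fmu); exact: mK.
- split.
    move=> [V [oV AV]] [W [oW AW]] /= WV; rewrite povs_leN2.
    by apply: (le_mu fmu) => //; exact: mK.
  rewrite -sup_inf_opp; case: inA => lb glb; apply/sup_rangeP; split=> [[V VP]|z zV].
    by apply: lb; exists V.
  by apply: glb => _ [V VP <-]; exact: (zV (exist _ V VP)).
Qed.

Let W := net_down (net_up (range pi)).
Let W' := net_up (net_down (range pi)).

Lemma net_down_up_opp y : W y -> W' (- y).
Proof.
by apply: net_down_opp => z; apply: net_up_opp; exact: range_piN.
Qed.

(** The set of [y] with both [y] and [- y] in [W] is a cone that contains [mu A] and [- mu A], hence
    all partial sums of the expansion. Keeping both signs serves all four sets in the first two
    inclusions. *)
Lemma bint_seq_up (f : X -> R) : bounded_borel f ->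
  seq_up [set y | W y /\ W (- y)] (bint mu f).
Proof.
move=> bf; have [M [D [M0 mD sv]]] := bint_expansion fmu mcE bf.
have cW : cone W by apply: cone_net_down; apply: cone_net_up; exact: cone_range_pi.
have cS : cone [set y | W y /\ W (- y)].
  exact: cone_setI cW (cone_opp cW).
have Smu A : borel A -> W (mu A) /\ W (- mu A).
  move=> mA; split; first exact: net_down_mu.
  by apply: net_down_mono (net_down_oppmu mA) => z [].
have [S0 SD SZ] := cS.
exists (fun N => - (M *: mu setT) + \sum_(n < N) ((M + M) / 2 ^+ n.+1) *: mu (D n)).
have c0 n : 0 <= (M + M) / 2 ^+ n.+1 by rewrite divr_ge0 ?addr_ge0// exprn_ge0.
split=> [N|].
  apply: SD.
    rewrite -scalerN; apply: SZ => //; rewrite /= opprK.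
    by have [] := Smu setT borel_setT.
  by apply: cone_sum => // n; apply: SZ => //; exact: Smu.
split=> //; apply/nondecreasing_seqP => N; rewrite big_ord_recr/= addrA.
by apply: povs_lerDl; apply: povs_scale_ge0 => //; exact: mu_ge0.
Qed.

(** The function [- f] is expanded instead of [f]: after negation the terms are nonpositive
    multiples of measures, as the diagonal argument requires, and the initial term [M *: mu setT] is
    admissible because [X] is open. *)
Lemma bint_seq_down_up (f : X -> R) : countable_sup_property E ->
  bounded_borel f -> seq_down (seq_up (range pi)) (bint mu f).
Proof.
move=> csp bf; have bnf := bounded_borelN bf.
have [M [D [M0 mD sv]]] := bint_expansion fmu mcE bnf.
have cU : cone (net_up (range pi)) by apply: cone_net_up; exact: cone_range_pi.
apply: (seq_down_mono (csp_net_up csp)).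
apply: (@seq_down_series _ _ _ (M *: mu setT)
  (fun n => ((M + M) / 2 ^+ n.+1) *: - mu (D n)) _ cU).
- by case: cU => _ _; apply=> //; apply: net_up_mu_open; exact: openT.
- move=> n; apply: csp_net_down => //.
  have cQ : cone [set z | net_up (range pi) z /\ z <= 0].
    exact: cone_setI cU cone_nonpos.
  case: (cone_net_down cQ) => _ _; apply; last exact: net_down_oppmu.
  by rewrite divr_ge0 ?addr_ge0// exprn_ge0.
move/sup_inf_opp : sv; rewrite bintN// opprK.
rewrite (_ : (fun N => - _) = (fun N => M *: mu setT +
  \sum_(n < N) ((M + M) / 2 ^+ n.+1) *: - mu (D n)))//.
apply/funext => N; rewrite opprD opprK -sumrN; congr (_ + _).
by apply: eq_bigr => n _; rewrite scalerN.
Qed.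

Lemma range_pi_I : range pi `<=` [set I_ mu f | f in bounded_borel].
Proof.
by move=> _ [f _ <-]; exists f; [exact: Cc_bounded_borel|rewrite pi_mu].
Qed.

Lemma I_boundedN y : [set I_ mu f | f in bounded_borel] y ->
  [set I_ mu f | f in bounded_borel] (- y).
Proof.
move=> [f bf <-]; exists (fun x => - f x); first exact: bounded_borelN.
by rewrite !(I_bint fmu mcE)// ?(bintN fmu mcE)//; exact: bounded_borelN.
Qed.

End Representation.

(** * Assembly of the inclusions and equalities *)

Theorem theorem5p11 (R : realType) (X : topologicalType) (E : povsType R)
    (pi : {linear Cc_space R X -> E}) (mu : set X -> E)
    (hausX : hausdorff_space X) (lcX : locally_compact [set: X])
    (mcE : monotone_complete E)
    (pi_ge0 : forall f : Cc_space R X, (forall x, (0 : R) <= f x) -> 0 <= pi f)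
    (mu_regular : regular_borel_measure mu)
    (mu_inner : forall A, borel A -> inner_regular_at mu A)
    (pi_mu : forall f : Cc_space R X, pi f = I_ mu f)
    (mu_open : forall V, open V ->
       sup_in (positive_cone E) [set pi f | f in [set f | prec_set f V]] (mu V))
    (mu_compact : forall K, compact K ->
       inf_in (positive_cone E) [set pi f | f in [set f | set_prec K f]] (mu K)) :
  [/\ [set I_ mu f | f in bounded_borel]
        `<=` seq_up (net_down (net_up (range pi)))
             `&` seq_down (net_up (net_down (range pi))),
      [set I_ mu f | f in bounded_borel]
        `<=` seq_down (net_down (net_up (range pi)))
             `&` seq_up (net_up (net_down (range pi))),
      countable_sup_property E -> preserves_moduli (L1fun mu) (I_ mu) ->
        [set I_ mu f | f in bounded_borel]
          `<=` seq_down (seq_up (range pi)) `&` seq_up (seq_down (range pi))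
    & countable_sup_property E -> preserves_moduli (L1fun mu) (I_ mu) ->
      L1_quotient mu = B_quotient mu ->
        [set I_ mu f | f in bounded_borel] = seq_down (seq_up (range pi)) /\
        [set I_ mu f | f in bounded_borel] = seq_up (seq_down (range pi))].
Proof.
have fmu := regular_borel_measure_finite mu_regular.
have IE f : bounded_borel f -> I_ mu f = bint mu f by exact: I_bint.
pose W := net_down (net_up (range pi)).
have up f : bounded_borel f -> seq_up [set y | W y /\ W (- y)] (bint mu f).
  by move=> bf; exact: bint_seq_up.
(* The sequence for [- f] is reflected below into one that decreases to the integral of [f]. *)
have upN f : bounded_borel f -> seq_up [set y | W y /\ W (- y)] (- bint mu f).
  by move=> bf; rewrite -(bintN fmu mcE bf); apply: up; exact: bounded_borelN.
have downup f : countable_sup_property E -> bounded_borel f ->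
    seq_down (seq_up (range pi)) (bint mu f).
  by move=> *; exact: bint_seq_down_up.
have updown f : countable_sup_property E -> bounded_borel f ->
    seq_up (seq_down (range pi)) (bint mu f).
  move=> csp bf; rewrite -(opprK (bint mu f)) -(bintN fmu mcE bf).
  apply: seq_down_opp (downup _ csp (bounded_borelN bf)) => y.
  by apply: seq_up_opp; exact: range_piN.
have inc (csp : countable_sup_property E) : [set I_ mu f | f in bounded_borel]
    `<=` seq_down (seq_up (range pi)) `&` seq_up (seq_down (range pi)).
  by move=> _ [f bf <-]; rewrite IE//; split; [exact: (downup _ csp bf)|exact: (updown _ csp bf)].
split.
- move=> _ [f bf <-]; rewrite IE//; split.
    by apply: seq_up_mono (up f bf) => y [].
  rewrite -(opprK (bint mu f)); apply: seq_up_opp (upN f bf) => y [Wy _].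
  exact: net_down_up_opp.
- move=> _ [f bf <-]; rewrite IE//; split.
    by rewrite -(opprK (bint mu f)); apply: seq_up_opp (upN f bf) => y [].
  apply: seq_up_mono (up f bf) => y [_ WNy]; rewrite -(opprK y).
  exact: net_down_up_opp.
- by move=> csp _; exact: inc.
- move=> csp pm L1B.
  (* The set of integrals contains [range pi] and is closed under increasing sequential limits,
     hence by symmetry under decreasing ones; both iterated limits therefore stay inside it. *)
  have upI := seq_up_I_bounded fmu mcE pm L1B.
  have downI : seq_down [set I_ mu f | f in bounded_borel] `<=`
      [set I_ mu f | f in bounded_borel].
    move=> y /(seq_down_opp (I_boundedN mcE mu_regular))/upI.
    by move/(I_boundedN mcE mu_regular); rewrite opprK.
  have rI := range_pi_I pi_mu.
  split; apply/seteqP; split=> [y /(inc csp)[]//|y].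
    by move=> /(seq_down_mono (subset_trans (seq_up_mono rI) upI)); exact: downI.
  by move=> /(seq_up_mono (subset_trans (seq_down_mono rI) downI)); exact: upI.
Qed.
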